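(* Let $G$ be a finite (i.e. having finitely many vertices) strongly connected directed graph with uncountably many edges. Then every derivation on $\mathcal{A}_G$ is inner, i.e. of the form $\delta_T$ for some $T\in\mathcal{A}_G$.
   Context: A directed graph $G=(\mathcal{V},\mathcal{E},s,r)$ has a vertex set $\mathcal{V}$ and an edge set $\mathcal{E}$ (loops and multiple edges allowed) and source and range maps $s,r\colon\mathcal{E}\to\mathcal{V}$; an edge $e$ is an arrow from $s(e)$ to $r(e)$. A directed graph is called finite if it has finitely many vertices (it may have infinitely many edges). $\mathbb{F}_G^+$ is the set of all directed paths of finite length: vertices $v$ are paths of length $0$ with $r(v)=s(v)=v$, and a path of length $n\geq1$ is $p=e_1e_2\cdots e_n$ with $s(e_j)=r(e_{j+1})$, $r(p)=r(e_1)$, $s(p)=s(e_n)$; if $s(p_1)=r(p_2)$, the product $p_1p_2$ is the concatenation. Let $\mathcal{H}_G=\ell^2(\mathbb{F}_G^+)$ with orthonormal basis $\{\xi_w\}$. For $e\in\mathcal{E}$, $L_e\xi_w=\xi_{ew}$ if $r(w)=s(e)$ and $0$ otherwise; for $x\in\mathcal{V}$, $L_x\xi_w=\xi_w$ if $r(w)=x$ and $0$ otherwise. $\mathcal{A}_G$ is the norm-closed algebra generated by $\{L_e,L_x\colon e\in\mathcal{E},x\in\mathcal{V}\}$ in $B(\mathcal{H}_G)$. A derivation on $\mathcal{A}_G$ is a linear map $\delta\colon\mathcal{A}_G\to\mathcal{A}_G$ (not assumed bounded) with $\delta(AB)=\delta(A)B+A\delta(B)$; $\delta_T(A)=AT-TA$.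 $G$ is strongly connected if for any vertices $x,y$ there is a directed path from $x$ to $y$. *)

(* Defs.v *)
From HB Require Import structures.
From mathcomp Require Import all_boot all_order all_algebra.
From mathcomp Require Import ring complex.
From mathcomp Require Import all_classical all_reals all_analysis.

Set Implicit Arguments.
Unset Strict Implicit.
Unset Printing Implicit Defensive.

Import Order.TTheory GRing.Theory Num.Theory.
Import ComplexField Normc.

Local Open Scope classical_set_scope.
Local Open Scope ring_scope.
Local Open Scope complex_scope.

Section SquareSum.
Variables (R : realType) (I : choiceType).
Implicit Types f g : I -> R[i].

Definition sqsum f : \bar R := \esum_(i in [set: I]) (normc (f i) ^+ 2)%:E.

Definition square_summable : {pred I -> R[i]} :=
  [pred f : I -> R[i] | (sqsum f < +oo)%E].

Lemma normc_ge0 (z : R[i]) : 0 <= normc z.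
Proof. by case: z => x y; exact: sqrtr_ge0. Qed.

Lemma sqterm_ge0 f i : (0 <= (normc (f i) ^+ 2)%:E)%E.
Proof. by rewrite lee_fin sqr_ge0. Qed.

Lemma sqsum_ge0 f : (0 <= sqsum f)%E.
Proof. by apply: esum_ge0 => i _; exact: sqterm_ge0. Qed.

Lemma sqsumZ (c : R[i]) f :
  (sqsum (c *: f) <= (normc c ^+ 2)%:E * sqsum f)%E.
Proof.
apply: ge_ereal_sup => _ [F [finF _] <-].
apply: (@le_trans _ _
  ((normc c ^+ 2)%:E * \sum_(i \in F) (normc (f i) ^+ 2)%:E)%E).
  rewrite ge0_mule_fsumr; last by move=> i; exact: sqterm_ge0.
  apply: lee_fsum => // i _.
  by rewrite -EFinM lee_fin -exprMn -normcM.
apply: lee_wpmul2l; first by rewrite lee_fin sqr_ge0.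
by apply: ereal_sup_ubound; exists F.
Qed.

Lemma square_summableZ (c : R[i]) f :
  (sqsum f < +oo)%E -> (sqsum (c *: f) < +oo)%E.
Proof.
move=> fl; apply: le_lt_trans (sqsumZ c f) _.
by apply: lte_mul_pinfty => //; rewrite lee_fin sqr_ge0.
Qed.

Lemma sqnormcD (a b : R[i]) :
  normc (a + b) ^+ 2 <= normc (2%:R * a) ^+ 2 + normc (2%:R * b) ^+ 2.
Proof.
have n2 : normc (2%:R : R[i]) = 2.
  by rewrite -(@rmorph_nat R R[i] (real_complex R) 2) /= expr0n addr0
    sqrtr_sqr ger0_norm.
rewrite !normcM n2.
apply: (@le_trans _ _ ((normc a + normc b) ^+ 2)).
  by rewrite lerXn2r ?nnegrE ?addr_ge0 ?normc_ge0 // le_normcD.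
rewrite -subr_ge0.
have -> : (2 * normc a) ^+ 2 + (2 * normc b) ^+ 2 - (normc a + normc b) ^+ 2 =
  2 * normc a ^+ 2 + 2 * normc b ^+ 2 + (normc a - normc b) ^+ 2 :> R by ring.
apply: addr_ge0; last exact: sqr_ge0.
by apply: addr_ge0; apply: mulr_ge0; rewrite ?ler0n ?sqr_ge0.
Qed.

Lemma square_summable_submod : submod_closed square_summable.
Proof.
split=> [|c f g].
  rewrite inE /sqsum esum1 // => i _.
  by have -> : (0 : I -> R[i]) i = 0 by []; rewrite normc0 expr0n.
rewrite !inE => fl gl.
apply: (@le_lt_trans _ _ (sqsum (2%:R *: (c *: f)) + sqsum (2%:R *: g))%E).
  rewrite /sqsum -esumD; [|by move=> i _; exact: sqterm_ge0..].
  by apply: le_esum => i _; rewrite -EFinD lee_fin; exact: sqnormcD.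
apply: lte_add_pinfty; last exact: square_summableZ.
by apply: square_summableZ; exact: square_summableZ.
Qed.

HB.instance Definition _ :=
  GRing.isSubmodClosed.Build R[i] (I -> R[i]) square_summable
    square_summable_submod.

End SquareSum.

Record ell2 (R : realType) (I : choiceType) :=
  Ell2 { ell2_fun :> I -> R[i]; _ : ell2_fun \in @square_summable R I }.

HB.instance Definition _ (R : realType) (I : choiceType) :=
  [isSub for @ell2_fun R I].
HB.instance Definition _ (R : realType) (I : choiceType) :=
  [Choice of ell2 R I by <:].
HB.instance Definition _ (R : realType) (I : choiceType) :=
  [SubChoice_isSubZmodule of ell2 R I by <:].
HB.instance Definition _ (R : realType) (I : choiceType) :=
  [SubZmodule_isSubLmodule of ell2 R I by <:].

Section BoundedOperators.
Variables (R : realType) (I : choiceType).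
Local Notation H := (ell2 R I).
Implicit Types (A B T : H -> H) (S : set (H -> H)).

Lemma sqsum_ltey (f : H) : (sqsum f < +oo)%E.
Proof. by have := valP f; rewrite inE. Qed.

Lemma sqsum_fin_num (f : H) : sqsum f \is a fin_num.
Proof. by rewrite (ge0_fin_numE (sqsum_ge0 f)) sqsum_ltey. Qed.

Definition l2norm (f : H) : R := Num.sqrt (fine (sqsum f)).

Definition bounded_operator T :=
  linear T /\ exists M : R, forall f, l2norm (T f) <= M * l2norm f.

(* [sup] of an unbounded set is a junk value: [opnorm] is only meaningful on
   bounded operators, to which its uses below are restricted. *)
Definition opnorm T : R := sup [set l2norm (T f) | f in [set f | l2norm f <= 1]].

Definition closed_subalgebra S :=
  [/\ S `<=` bounded_operator,
      S 0,
      forall (c : R[i]) A B, S A -> S B -> S (c *: A + B),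
      forall A B, S A -> S B -> S (A \o B) &
      forall T, bounded_operator T ->
        (forall e : R, 0 < e -> exists2 A, S A & opnorm (T - A) < e) -> S T].

(* A map from the algebra S to itself is encoded by a map on all of H -> H whose
   values outside S are irrelevant. *)
Definition derivation S (delta : (H -> H) -> (H -> H)) :=
  [/\ forall A, S A -> S (delta A),
      forall (c : R[i]) A B, S A -> S B ->
        delta (c *: A + B) = c *: delta A + delta B &
      forall A B, S A -> S B ->
        delta (A \o B) = (delta A \o B) + (A \o delta B)].

Definition inner_derivation S (delta : (H -> H) -> (H -> H)) :=
  exists2 T, S T & forall A, S A -> delta A = (A \o T) - (T \o A).

End BoundedOperators.

Record digraph := Digraph {
  vertex : choiceType;
  edge : choiceType;
  src : edge -> vertex;
  rng : edge -> vertex }.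

Section Paths.
Variable G : digraph.
Local Notation V := (vertex G).
Local Notation E := (edge G).

Fixpoint is_path (v : V) (p : seq E) : bool :=
  if p is e :: q then (rng e == v) && is_path (src e) q else true.

(* [(r, [:: e1; ...; en])] is the path e1 ... en with range r; the vertex v,
   as a path of length 0, is [(v, [::])]. *)
Definition dipath := {w : V * seq E | is_path w.1 w.2}.

Definition prange (w : dipath) : V := (val w).1.
Definition pedges (w : dipath) : seq E := (val w).2.
Definition psource (w : dipath) : V := last (prange w) (map (@src G) (pedges w)).

Lemma pcons_subproof e (w : dipath) :
  src e = prange w -> is_path (rng e) (e :: pedges w).
Proof. by move=> /= ->; rewrite eqxx; exact: (svalP w). Qed.

Definition pcons e (w : dipath) (ew : src e = prange w) : dipath :=
  exist _ (rng e, e :: pedges w) (pcons_subproof ew).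

Lemma ptail_subproof (w : dipath) :
  let u := if pedges w is e :: q then (src e, q) else val w in is_path u.1 u.2.
Proof. by case: w => [[v [|e q]]] //= /andP[]. Qed.

(* e1 e2 ... en |-> e2 ... en; paths of length 0 are left unchanged *)
Definition ptail (w : dipath) : dipath :=
  exist (fun u : V * seq E => is_path u.1 u.2) _ (ptail_subproof w).

Lemma pconsK e w (ew : src e = prange w) : ptail (pcons ew) = w.
Proof.
case: w ew => [[v p] w_path] ew; apply: val_inj.
by rewrite /= ew.
Qed.

Lemma ptailK e w : ohead (pedges w) = Some e ->
  exists h : src e = prange (ptail w), pcons h = w.
Proof.
case: w => [[v [|e' q]]] //= w_path [ee']; rewrite -{}ee'.
by exists erefl; apply: val_inj => /=; have /andP[/eqP-> _] := w_path.
Qed.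

Definition strongly_connected :=
  forall x y : V, exists w : dipath, psource w = x /\ prange w = y.

End Paths.

Section CreationOperators.
Variables (R : realType) (G : digraph).
Local Notation H := (ell2 R (dipath G)).

(* L_e and L_x in coordinates with respect to the orthonormal basis (xi w);
   [Ledge_xi], [Ledge_xi0] and [Lvertex_xi] give their action on the basis. *)
Definition edge_coef (e : edge G) (f : dipath G -> R[i]) : dipath G -> R[i] :=
  fun w => if ohead (pedges w) == Some e then f (ptail w) else 0.

Definition vertex_coef (x : vertex G) (f : dipath G -> R[i]) : dipath G -> R[i] :=
  fun w => if prange w == x then f w else 0.

Lemma sqsum_edge_coef e f : (sqsum (edge_coef e f) <= sqsum f)%E.
Proof.
rewrite /sqsum.
set D := [set w : dipath G | ohead (pedges w) == Some e].
have -> : (\esum_(i in [set: dipath G]) (normc (edge_coef e f i) ^+ 2)%:E =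
    \esum_(i in D) (normc (f (ptail i)) ^+ 2)%:E)%E.
  rewrite [RHS]esum_mkcond; apply: eq_esum => w _; rewrite /edge_coef.
  have -> : (w \in D) = (ohead (pedges w) == Some e).
    by apply/idP/idP; rewrite inE.
  by case: ifP => //; rewrite normc0 expr0n.
rewrite -(@esum_image _ _ _ D (@ptail G) (fun w => (normc (f w) ^+ 2)%:E)).
  rewrite esum_mkcond; apply: le_esum => w _.
  by case: ifP => // _; exact: sqterm_ge0.
move=> u w /[!inE] /eqP ue /eqP we uw.
have [hu <-] := ptailK ue; have [hw <-] := ptailK we.
by apply: val_inj; rewrite /= uw.
Qed.

Lemma sqsum_vertex_coef x f : (sqsum (vertex_coef x f) <= sqsum f)%E.
Proof.
apply: le_esum => w _; rewrite /vertex_coef; case: ifP => // _.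
by rewrite normc0 expr0n; exact: sqterm_ge0.
Qed.

Lemma edge_coef_subproof e (f : H) :
  edge_coef e f \in @square_summable R (dipath G).
Proof.
by rewrite inE; apply: le_lt_trans (sqsum_edge_coef e f) _; exact: sqsum_ltey.
Qed.

Lemma vertex_coef_subproof x (f : H) :
  vertex_coef x f \in @square_summable R (dipath G).
Proof.
by rewrite inE; apply: le_lt_trans (sqsum_vertex_coef x f) _; exact: sqsum_ltey.
Qed.

Definition Ledge e (f : H) : H := Ell2 (edge_coef_subproof e f).

Definition Lvertex x (f : H) : H := Ell2 (vertex_coef_subproof x f).

Lemma l2norm_contraction (T : H -> H) :
  (forall f, sqsum (T f) <= sqsum f)%E -> forall f, l2norm (T f) <= 1 * l2norm f.
Proof.
move=> Tf f; rewrite mul1r /l2norm ler_wsqrtr // fine_le ?sqsum_fin_num //.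
Qed.

Lemma Ledge_bounded e : bounded_operator (Ledge e).
Proof.
split; last by exists 1; apply: l2norm_contraction => f; exact: sqsum_edge_coef.
move=> c f g; apply: val_inj; apply/funext => w /=.
rewrite !fctE /= /edge_coef; case: ifP => // _.
by rewrite scaler0 addr0.
Qed.

Lemma Lvertex_bounded x : bounded_operator (Lvertex x).
Proof.
split; last by exists 1; apply: l2norm_contraction => f; exact: sqsum_vertex_coef.
move=> c f g; apply: val_inj; apply/funext => w /=.
rewrite !fctE /= /vertex_coef; case: ifP => // _.
by rewrite scaler0 addr0.
Qed.

Definition xi_coef (w u : dipath G) : R[i] := (u == w)%:R.

Lemma xi_subproof w : xi_coef w \in @square_summable R (dipath G).
Proof.
rewrite inE /sqsum.
rewrite (eq_esum (b := fun u => if u \in [set w] then 1%E else 0%E)).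
  by rewrite -esum_mkcond esum_set1 ?ltry.
move=> u _; rewrite /xi_coef.
have -> : (u \in [set w]) = (u == w) by apply/idP/eqP; rewrite inE.
by case: eqP => _; rewrite ?normc0 ?normc1 ?expr0n ?expr1n.
Qed.

Definition xi w : H := Ell2 (xi_subproof w).

Lemma Ledge_xi e w (ew : src e = prange w) : Ledge e (xi w) = xi (pcons ew).
Proof.
apply: val_inj; apply/funext => u /=; rewrite /edge_coef /xi_coef.
case: eqP => [/ptailK[h hu]|ue].
  congr (nat_of_bool _)%:R; apply/eqP/eqP => [uw|->]; last exact: pconsK.
  by rewrite -hu; apply: val_inj; rewrite /= uw.
by case: eqP => // uw; case: ue; rewrite uw.
Qed.

Lemma Ledge_xi0 e w : src e <> prange w -> Ledge e (xi w) = 0.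
Proof.
move=> ew; apply: val_inj; apply/funext => u /=; rewrite /edge_coef /xi_coef.
by case: eqP => [/ptailK[h _]|//]; case: eqP => // uw; case: ew; rewrite -uw.
Qed.

Lemma Lvertex_xi x w :
  Lvertex x (xi w) = if prange w == x then xi w else 0.
Proof.
apply: val_inj; apply/funext => u /=; rewrite /vertex_coef /xi_coef.
have [->|uw] := eqVneq u w; first by case: ifP => //= _; rewrite /xi_coef eqxx.
by case: ifP => _; case: ifP => //= _; rewrite /xi_coef (negPf uw).
Qed.

(* The norm-closed algebra A_G generated by the L_e and the L_x. *)
Definition tensor_algebra : set (H -> H) :=
  smallest (@closed_subalgebra R (dipath G))
    (range Ledge `|` range Lvertex).

End CreationOperators.

Arguments tensor_algebra : clear implicits.

(* Main.v *)
Require Import Defs.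
From mathcomp Require Import all_boot all_order all_algebra.
From mathcomp Require Import finmap ring lra complex.
From mathcomp Require Import all_classical all_reals all_analysis.

Set Implicit Arguments.
Unset Strict Implicit.
Unset Printing Implicit Defensive.

Import Order.TTheory GRing.Theory Num.Theory.
Import ComplexField Normc.

Local Open Scope classical_set_scope.
Local Open Scope ring_scope.
Local Open Scope complex_scope.

(** Write xi_w for the basis vectors, L_w for the creation operator of a path w
and A(w) for the Fourier coefficients of an operator A of the algebra, so that
formally A is the sum of the A(w) L_w. If delta were A |-> A T - T A with T
commuting with the vertex projections, and f were an edge that does not occur
in T, then T(w) could be read off as the coefficient of delta (L_f) at f w. The
proof defines T in this way.

Automatic continuity ([continuity_at]). Two words v and d that start with
different edges have creation operators with orthogonal ranges. If delta were
unbounded along contractions A_i, the elements B_i = L_d A_i + (1/4) L_v B_(i+1)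
of the algebra would contradict the Leibniz rule: applying the adjoint of L_v
shows that delta (B_i) grows at most geometrically in i, applying the adjoint of
L_d shows the same for delta (A_i), and the A_i can be chosen to violate any
prescribed growth.

Test elements ([delta_loop_coef]). For a loop v the norms of delta (L_v^n) are
bounded in n. By the Leibniz rule, delta (L_v^n) is the sum of the
L_v^j delta (L_v) L_v^(n-1-j). If no v^p u with p > 0 ends with v and no u v^q
starts with v, then each of the n words v^p u v^q with p + q = n - 1 occurs in
just one of these summands and carries the coefficient of delta (L_v) at u.
Since the squared coefficients are summable, with a sum bounded in n, this
coefficient vanishes.

Fresh edges. After an inner derivation is subtracted, delta kills the vertex
projections ([vertex_inner]). Some pair of vertices x0, z0 is joined by
uncountably many edges from x0 to z0. Fix paths a_x from x to x0 and countably
many paths c from z0 to the vertices. Vectors of l^2 have countable support, so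
only countably many edges occur in the a_x, in the c and in the delta (L_c); the
other edges f from x0 to z0 are fresh. The loop f a_x c gives
delta (L_(f a_x))(f a_x w) = - delta (L_c)(w c) ([tcoefE]): a loop c that
contains an edge foreign to w makes the test apply, and the right-hand side does
not mention f. Hence the left-hand side is the coefficient T(w) of one operator
T, whichever fresh f is used, and T lies in the algebra because left division by
a path preserves the algebra ([left_division]). For an edge e from x to y and f
not occurring in the word considered, the Leibniz rule for L_(f a_y) L_e yields
delta (L_e) = L_e T - T L_e ([delta_edge_coef]). Continuity extends this identity
from the generators to the whole algebra ([inner_closed]). *)

(** * Square sums *)

Section SquareSums.
Variables (R : realType) (I : choiceType).
Local Notation H := (ell2 R I).
Implicit Types (f g h : H) (T : H -> H).

(** The squared norm is the working quantity: it is a sum of squares of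
coordinates, so that bounds pass through finite partial sums. *)
Definition sq f : R := fine (sqsum f).

Lemma sq_ge0 f : 0 <= sq f.
Proof. exact/fine_ge0/sqsum_ge0. Qed.

Lemma sum_le_sq f (W : seq I) : uniq W ->
  \sum_(w <- W) normc (f w) ^+ 2 <= sq f.
Proof.
move=> uW; rewrite -lee_fin fineK ?sqsum_fin_num // -sumEFin.
apply: esum_ge; exists [set` W]; first by split=> //; exact: finite_seq.
by rewrite fsbig_seq.
Qed.

Lemma sqsum_le (k : I -> R[i]) (M : R) :
  (forall W, uniq W -> \sum_(w <- W) normc (k w) ^+ 2 <= M) ->
  (sqsum k <= M%:E)%E.
Proof.
move=> kM; apply: ge_ereal_sup => _ [F [finF _] <-].
rewrite fsbig_finite //= sumEFin lee_fin.
exact/kM/fset_uniq.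
Qed.

Lemma sq_le f (M : R) :
  (forall W, uniq W -> \sum_(w <- W) normc (f w) ^+ 2 <= M) -> sq f <= M.
Proof. by move=> fM; rewrite -lee_fin fineK ?sqsum_fin_num //; exact: sqsum_le. Qed.

Lemma ell2P (k : I -> R[i]) (M : R) :
  (forall W, uniq W -> \sum_(w <- W) normc (k w) ^+ 2 <= M) ->
  k \in @square_summable R I.
Proof. by move=> kM; rewrite inE; apply: le_lt_trans (sqsum_le kM) (ltry _). Qed.

Lemma entry_le_sq f i : normc (f i) ^+ 2 <= sq f.
Proof. by have := @sum_le_sq f [:: i] isT; rewrite big_seq1. Qed.

Lemma ell2_ext f g : (forall i, f i = g i) -> f = g.
Proof. by move=> fg; apply: val_inj; apply/funext. Qed.

Lemma ell2D f g i : (f + g) i = f i + g i. Proof. by []. Qed.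
Lemma ell2Z (c : R[i]) f i : (c *: f) i = c * f i. Proof. by []. Qed.
Lemma ell2N f i : (- f) i = - f i. Proof. by []. Qed.
Lemma ell20 i : (0 : H) i = 0. Proof. by []. Qed.

Lemma normcN (z : R[i]) : normc (- z) = normc z.
Proof. by case: z => a b /=; rewrite !sqrrN. Qed.

Lemma normc_real (r : R) : 0 <= r -> normc (r%:C) = r.
Proof. by move=> r0 /=; rewrite expr0n addr0 sqrtr_sqr ger0_norm. Qed.

Lemma normc_nat n : normc (n%:R : R[i]) = n%:R.
Proof. by rewrite -(rmorph_nat (real_complex R)) normc_real. Qed.

Lemma normcZ2 (z : R[i]) : normc (2%:R * z) ^+ 2 = 4 * normc z ^+ 2.
Proof. by rewrite normcM normc_nat; ring. Qed.

(** A crude substitute for Minkowski's inequality: the estimates below have room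
for the constants. *)
Lemma sqD f g : sq (f + g) <= 4 * sq f + 4 * sq g.
Proof.
apply: sq_le => W uW.
apply: (@le_trans _ _ (\sum_(w <- W) (4 * normc (f w) ^+ 2 + 4 * normc (g w) ^+ 2))).
  by apply: ler_sum => w _; rewrite -!normcZ2; exact: sqnormcD.
by rewrite big_split /= -!mulr_sumr lerD // ler_wpM2l // sum_le_sq.
Qed.

Lemma sqN f : sq (- f) = sq f.
Proof.
by rewrite /sq /sqsum; congr fine; apply: eq_esum => i _; rewrite ell2N normcN.
Qed.

Lemma sqB f g : sq (f - g) <= 4 * sq f + 4 * sq g.
Proof. by rewrite -(sqN g); exact: sqD. Qed.

Lemma sqZ (c : R[i]) f : sq (c *: f) <= normc c ^+ 2 * sq f.
Proof.
rewrite -lee_fin EFinM !fineK ?sqsum_fin_num //; exact: sqsumZ.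
Qed.

Lemma sq0 : sq (0 : H) = 0.
Proof.
apply/eqP; rewrite eq_le sq_ge0 andbT; apply: sq_le => W _.
by rewrite big1 // => i _; rewrite ell20 normc0 expr0n.
Qed.

Lemma l2normE f : l2norm f = Num.sqrt (sq f). Proof. by []. Qed.

Lemma l2norm_sq f : l2norm f ^+ 2 = sq f.
Proof. by rewrite l2normE sqr_sqrtr // sq_ge0. Qed.

(** Only finitely many coordinates exceed 1/(n+1) in squared modulus, since each
of them contributes to the convergent sum of squares. *)
Lemma countable_support f : countable [set i | f i != 0].
Proof.
have -> : [set i | f i != 0] =
    \bigcup_(n in [set: nat]) [set i | n.+1%:R^-1 < normc (f i) ^+ 2].
  apply/seteqP; split=> [i /= fi|i [n _] /= ni].
    have p : 0 < normc (f i) ^+ 2.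
      rewrite exprn_gt0 // lt_neqAle normc_ge0 andbT eq_sym.
      by apply: contra fi => /eqP/eq0_normc ->.
    have [n _ /= hn] := @near_infty_natSinv_lt R (PosNum p).
    by exists n => //=; exact: hn (leqnn n).
  apply/eqP => f0; move: ni; rewrite f0 normc0 expr0n /= ltNge.
  by rewrite invr_ge0 ler0n.
apply: bigcup_countable => [//|n _]; apply: finite_set_countable.
apply: contrapT => /infinite_set_fset - /(_ (Num.truncn (sq f * n.+1%:R)).+1)%N.
case=> F sub lt.
have := @sum_le_sq f F (fset_uniq _); apply/negP; rewrite -ltNge.
apply: (@lt_le_trans _ _ (\sum_(w <- F) n.+1%:R^-1)); last first.
  by rewrite big_seq [leRHS]big_seq; apply: ler_sum => w /sub /ltW.
rewrite big_const_seq count_predT iter_addr_0 -[ltRHS]mulr_natl.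
rewrite ltr_pdivlMr ?ltr0n //.
have := truncnS_gt (sq f * n.+1%:R); move/lt_le_trans; apply.
by rewrite ler_nat.
Qed.

End SquareSums.

(** * Bounded operators *)

Section BoundedOps.
Variables (R : realType) (I : choiceType).
Local Notation H := (ell2 R I).
Implicit Types (f g h : H) (T A B : H -> H).

Definition sqbound (M : R) T := forall f, sq (T f) <= M * sq f.

Lemma boundedP T : bounded_operator T <-> linear T /\ exists M, sqbound M T.
Proof.
split=> -[linT [M MT]]; split=> //.
  exists (M ^+ 2) => f; rewrite -!l2norm_sq -exprMn.
  rewrite lerXn2r ?nnegrE ?sqrtr_ge0 //.
  exact: le_trans (sqrtr_ge0 _) (MT f).
exists (Num.sqrt (Num.max M 0)) => f; rewrite !l2normE -sqrtrM ?le_max ?lexx ?orbT //.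
rewrite ler_wsqrtr //; apply: le_trans (MT f) _.
by rewrite ler_wpM2r ?sq_ge0 // le_max lexx.
Qed.

Lemma bounded_sqbound T : bounded_operator T ->
  exists2 M, 0 <= M & sqbound M T.
Proof.
move=> /boundedP[_ [M MT]]; exists (Num.max M 0); first by rewrite le_max lexx orbT.
move=> f; apply: le_trans (MT f) _.
by rewrite ler_wpM2r ?sq_ge0 // le_max lexx.
Qed.

Section Linear.
Variables (T : H -> H) (linT : linear T).
Lemma linop0 : T 0 = 0.
Proof. by have := linT (-1) 0 0; rewrite scaler0 addr0 scaleN1r addNr. Qed.
Lemma linopD f g : T (f + g) = T f + T g.
Proof. by have := linT 1 f g; rewrite !scale1r. Qed.
Lemma linopZ c f : T (c *: f) = c *: T f.
Proof. by have := linT c f 0; rewrite linop0 !addr0. Qed.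
Lemma linopN f : T (- f) = - T f.
Proof. by rewrite -scaleN1r linopZ scaleN1r. Qed.
Lemma linopB f g : T (f - g) = T f - T g.
Proof. by rewrite linopD linopN. Qed.
Lemma linop_sum (J : Type) (r : seq J) (F : J -> H) :
  T (\sum_(j <- r) F j) = \sum_(j <- r) T (F j).
Proof. by elim/big_rec2: _ => [|j x y _ <-]; rewrite ?linop0 ?linopD. Qed.
End Linear.

Lemma opnorm_le (M : R) T : 0 <= M -> linear T -> sqbound M T ->
  opnorm T <= Num.sqrt M.
Proof.
move=> M0 linT MT; apply: ge_sup => [|_ [f /= f1 <-]].
  by exists (l2norm (T 0)), 0 => //=; rewrite l2normE sq0 sqrtr0.
rewrite l2normE ler_wsqrtr //; apply: le_trans (MT f) _.
rewrite ler_piMr // -(@ler_sqrt _ _ 1) ?sqrtr1 //.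
Qed.

(** Here the supremum defining the norm is finite because the operator is known
to be bounded; homogeneity extends the bound from the unit ball. *)
Lemma opnorm_sqbound (e : R) T : bounded_operator T -> opnorm T < e ->
  sqbound (e ^+ 2) T.
Proof.
move=> bT Te f; have [linT _] := bT; have [M M0 MT] := bounded_sqbound bT.
have ub : forall g, l2norm g <= 1 -> l2norm (T g) <= e.
  move=> g g1; apply: le_trans (ltW Te); apply: ub_le_sup; last by exists g.
  exists (Num.sqrt M) => _ [k /= k1 <-].
  rewrite l2normE ler_wsqrtr //; apply: le_trans (MT k) _.
  by rewrite ler_piMr // -(@ler_sqrt _ _ 1) ?sqrtr1.
have e0 : 0 <= e.
  apply: le_trans (sqrtr_ge0 _) (ub 0 _).
  by rewrite l2normE sq0 sqrtr0.
have [f0|fn0] := eqVneq (sq f) 0.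
  by have := MT f; rewrite f0 !mulr0.
have fp : 0 < sq f by rewrite lt_neqAle eq_sym fn0 sq_ge0.
set c : R := Num.sqrt (sq f).
have cp : 0 < c by rewrite sqrtr_gt0.
have := ub (((c^-1)%:C) *: f) _; rewrite linopZ // => ub1.
have : sq ((c^-1)%:C *: T f) <= e ^+ 2.
  rewrite -l2norm_sq lerXn2r ?nnegrE ?sqrtr_ge0 // ub1 //.
  rewrite l2normE -(sqrtr1 R) ler_wsqrtr //; apply: le_trans (sqZ _ _) _.
  rewrite normc_real ?invr_ge0 ?(ltW cp) // exprVn sqr_sqrtr ?sq_ge0 //.
  by rewrite mulVf.
move=> Tfe; have -> : T f = c%:C *: ((c^-1)%:C *: T f).
  rewrite scalerA -rmorphM mulfV ?gt_eqF // rmorph1 scale1r //.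
apply: le_trans (sqZ _ _) _; rewrite normc_real ?(ltW cp) // sqr_sqrtr ?sq_ge0 //.
by rewrite mulrC ler_wpM2r ?sq_ge0.
Qed.

End BoundedOps.

(** * Coordinates on words *)

Section Words.
Variables (R : realType) (G : digraph).
Local Notation C := R[i].
Local Notation V := (vertex G).
Local Notation E := (edge G).
Local Notation P := (dipath G).
Local Notation H := (ell2 R P).
Local Notation is_path := (@is_path G).
Implicit Types (h k : H) (x y z : V) (s t : seq E) (e : E).

(** Coordinates are indexed by raw pairs of a range and a list of edges, with the
value 0 on pairs that are not paths, so that words can be concatenated and cut
without proofs attached to them. *)
Definition entry h y s : C := if insub (y, s) is Some w then h (w : P) else 0.

Definition wsrc y s : V := last y (map (@src G) s).

Lemma wsrc_cat y s t : wsrc y (s ++ t) = wsrc (wsrc y s) t.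
Proof. by rewrite /wsrc map_cat last_cat. Qed.

Lemma wsrc_rcons y s e : wsrc y (rcons s e) = src e.
Proof. by rewrite /wsrc map_rcons last_rcons. Qed.

Lemma path_cat y s t : is_path y (s ++ t) = is_path y s && is_path (wsrc y s) t.
Proof. by elim: s y => //= e s IH y; rewrite IH andbA. Qed.

Lemma entry_path h (w : P) : entry h (prange w) (pedges w) = h w.
Proof.
case: w => [[y s] w]; rewrite /entry /prange /pedges /=.
by rewrite (insubT (fun u : V * seq E => is_path u.1 u.2) w).
Qed.

Lemma entry_nopath h y s : ~~ is_path y s -> entry h y s = 0.
Proof. by move=> nw; rewrite /entry insubN. Qed.

Lemma entryE h y s (w : is_path y s) :
  entry h y s = h (exist (fun u : V * seq E => is_path u.1 u.2) (y, s) w).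
Proof. by rewrite -entry_path. Qed.

Lemma entry_ext h k : (forall y s, entry h y s = entry k y s) -> h = k.
Proof. by move=> hk; apply: ell2_ext => w; rewrite -!entry_path. Qed.

Lemma entryD h k y s : entry (h + k) y s = entry h y s + entry k y s.
Proof. by rewrite /entry; case: insub => [w|]; rewrite ?ell2D ?addr0. Qed.

Lemma entryZ (c : C) h y s : entry (c *: h) y s = c * entry h y s.
Proof. by rewrite /entry; case: insub => [w|]; rewrite ?ell2Z ?mulr0. Qed.

Lemma entryN h y s : entry (- h) y s = - entry h y s.
Proof. by rewrite /entry; case: insub => [w|]; rewrite ?ell2N ?oppr0. Qed.

Lemma entryB h k y s : entry (h - k) y s = entry h y s - entry k y s.
Proof. by rewrite entryD entryN. Qed.

Lemma entry0 y s : entry 0 y s = 0.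
Proof. by rewrite /entry; case: insub. Qed.

Lemma entry_sum (J : Type) (r : seq J) (F : J -> H) y s :
  entry (\sum_(j <- r) F j) y s = \sum_(j <- r) entry (F j) y s.
Proof. by elim/big_rec2: _ => [|j a b _ <-]; rewrite ?entry0 ?entryD. Qed.

Lemma entry_le_sqr h y s : normc (entry h y s) ^+ 2 <= sq h.
Proof.
rewrite /entry; case: insub => [w|]; first exact: entry_le_sq.
by rewrite normc0 expr0n sq_ge0.
Qed.

Lemma sum_entry_le_sq h y (W : seq (seq E)) : uniq W ->
  \sum_(s <- W) normc (entry h y s) ^+ 2 <= sq h.
Proof.
move=> uW; pose W' : seq P := pmap (fun s => insub (y, s)) W.
have uW' : uniq W'.
  rewrite /W' {W'}; elim: W uW => //= s W IH /andP[sW uW].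
  case: insubP => [w _ wE|_] /=; last exact: IH.
  rewrite IH // andbT mem_pmap; apply/mapP => -[t tW].
  case: insubP => // w' _ w'E [ww']; move: w'E; rewrite -ww' wE => -[st].
  by rewrite st tW in sW.
apply: le_trans (sum_le_sq h uW').
rewrite /W' {uW' W' uW}; elim: W => /= [|s W IH]; first by rewrite !big_nil.
rewrite big_cons /entry; case: insub => [w|].
  by rewrite /= big_cons lerD2l.
by rewrite normc0 expr0n add0r.
Qed.

Lemma entry_edge e h y s : entry (Ledge e h) y s =
  if s is e' :: s' then
    if (e' == e) && (y == rng e) then entry h (src e) s' else 0
  else 0.
Proof.
have [w|nw] := boolP (is_path y s); last first.
  rewrite entry_nopath //; case: s nw => //= e' s' nw.
  case: ifP => // /andP[/eqP ee /eqP ye]; rewrite entry_nopath //.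
  by move: nw; rewrite ee ye eqxx.
rewrite entryE /= /edge_coef /=; case: s w => //= e' s' w.
have -> : (Some e' == Some e) = (e' == e) by [].
case/andP: (w) => /eqP re w'; case: eqVneq => //= ee.
have -> : (y == rng e) by rewrite -re -ee.
by rewrite -entry_path -ee.
Qed.

Lemma entry_vertex x h y s :
  entry (Lvertex x h) y s = if y == x then entry h y s else 0.
Proof.
have [w|nw] := boolP (is_path y s); last by rewrite !entry_nopath // if_same.
by rewrite !entryE.
Qed.

Definition tpath x : P :=
  exist (fun u : V * seq E => is_path u.1 u.2) (x, [::]) isT.

(** The vacuum vector of the vertex x. *)
Definition vac x : H := xi R (tpath x).

Lemma entry_vac x y s : entry (vac x) y s = ((y == x) && (s == [::]))%:R.
Proof.
have [w|nw] := boolP (is_path y s); last first.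
  by rewrite entry_nopath //; case: eqP nw => // _; case: eqP => // -> .
by rewrite entryE /= /xi_coef -val_eqE.
Qed.

Fixpoint Lword s : H -> H := if s is e :: s' then Ledge e \o Lword s' else id.

Lemma Lword_cat s t h : Lword (s ++ t) h = Lword s (Lword t h).
Proof. by elim: s => //= e s ->. Qed.

Lemma Ledge_linear e : linear (Ledge e : H -> H).
Proof. by have [] := Ledge_bounded R e. Qed.

Lemma Lvertex_linear x : linear (Lvertex x : H -> H).
Proof. by have [] := Lvertex_bounded R x. Qed.

Lemma Lword_linear s : linear (Lword s).
Proof. by elim: s => //= e s IH c h k; rewrite /= IH Ledge_linear. Qed.

Lemma sq_edge e h : sq (Ledge e h) <= sq h.
Proof. by rewrite fine_le ?sqsum_fin_num //; exact: sqsum_edge_coef. Qed.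

Lemma sq_vertex x h : sq (Lvertex x h) <= sq h.
Proof. by rewrite fine_le ?sqsum_fin_num //; exact: sqsum_vertex_coef. Qed.

Lemma sq_word s h : sq (Lword s h) <= sq h.
Proof. by elim: s => //= e s; apply: le_trans (sq_edge _ _). Qed.

Lemma entry_word t h y s : entry (Lword t h) y s =
  if prefix t s && is_path y t then entry h (wsrc y t) (drop (size t) s) else 0.
Proof.
elim: t y s => [|e t IH] y s /=; first by rewrite prefix0s /= drop0.
rewrite entry_edge; case: s => // e' s.
rewrite /= eq_sym [y == _]eq_sym; case: eqP => //= ->.
case: eqP => _; rewrite ?andbF //= IH.
Qed.

Lemma entry_word_cat t h y s : is_path y t ->
  entry (Lword t h) y (t ++ s) = entry h (wsrc y t) s.
Proof. by move=> w; rewrite entry_word prefix_prefix w drop_size_cat. Qed.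

(** ** The adjoints of the creation operators *)

(** The adjoint of the creation operator of the path with range y and edges t,
in coordinates. *)
Definition adj_coef y t h : P -> C :=
  fun w => if prange w == wsrc y t then entry h y (t ++ pedges w) else 0.

Lemma adj_coef_sum y t h (W : seq P) : uniq W ->
  \sum_(w <- W) normc (adj_coef y t h w) ^+ 2 <= sq h.
Proof.
move=> uW; pose W' := [seq w <- W | prange w == wsrc y t].
apply: (@le_trans _ _ (\sum_(s <- [seq t ++ pedges w | w <- W'])
    normc (entry h y s) ^+ 2)).
  rewrite big_map /W' big_filter [leRHS]big_mkcond /=; apply: ler_sum => w _.
  by rewrite /adj_coef; case: eqP; rewrite // normc0 expr0n.
apply: sum_entry_le_sq; rewrite map_inj_in_uniq ?filter_uniq //.
move=> u w; rewrite !mem_filter => /andP[/eqP ru _] /andP[/eqP rw _] /eqP.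
rewrite eqseq_cat // eqxx /= => /eqP uw; apply: val_inj.
case: u w ru rw uw => [[a b] p] [[a' b'] p'].
by rewrite /prange /pedges /= => -> -> ->.
Qed.

Definition adj y t h : H := Ell2 (ell2P (@adj_coef_sum y t h)).

Lemma entry_adj y t h z s : is_path y t ->
  entry (adj y t h) z s = if z == wsrc y t then entry h y (t ++ s) else 0.
Proof.
move=> pt; have [w|nw] := boolP (is_path z s); first by rewrite entryE.
rewrite entry_nopath //; case: eqP => // zE.
by rewrite entry_nopath // path_cat -zE (negPf nw) andbF.
Qed.

Lemma sq_adj y t h : sq (adj y t h) <= sq h.
Proof. by apply: sq_le => W uW; exact: adj_coef_sum. Qed.

Lemma adj_linear y t : linear (adj y t).
Proof.
move=> c h k; apply: ell2_ext => w; rewrite ell2D ell2Z /= /adj_coef.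
by case: ifP => _; rewrite ?entryD ?entryZ ?mulr0 ?addr0.
Qed.

Lemma adj_word y t h : is_path y t ->
  adj y t (Lword t h) = Lvertex (wsrc y t) h.
Proof.
move=> pt; apply: entry_ext => z s; rewrite entry_adj // entry_vertex.
by case: eqP => [->|//]; rewrite entry_word_cat.
Qed.

Lemma adj_vertex y t h : adj y t (Lvertex y h) = adj y t h.
Proof.
apply: ell2_ext => w; rewrite /= /adj_coef; case: eqP => // _.
by rewrite entry_vertex eqxx.
Qed.

End Words.
Arguments wsrc {G}.
Arguments vac R {G}.
Arguments Lword R {G}.

(** * The tensor algebra *)

Section Approximation.
Variables (R : realType) (I : choiceType).
Local Notation H := (ell2 R I).
Implicit Types (f g h : H) (T A B : H -> H) (S : set (H -> H)).

Lemma op0 f : (0 : H -> H) f = 0. Proof. by []. Qed.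
Lemma opD A B f : (A + B) f = A f + B f. Proof. by []. Qed.
Lemma opZ (c : R[i]) A f : (c *: A) f = c *: A f. Proof. by []. Qed.
Lemma opB A B f : (A - B) f = A f - B f. Proof. by []. Qed.

Lemma bounded_lincomb (c : R[i]) A B :
  bounded_operator A -> bounded_operator B -> bounded_operator (c *: A + B).
Proof.
move=> bA bB; have [linA _] := bA; have [linB _] := bB.
have [M M0 MA] := bounded_sqbound bA; have [N N0 NB] := bounded_sqbound bB.
apply/boundedP; split=> [a f g|].
  rewrite !fctE /= (linopD linA) (linopZ linA) (linopD linB) (linopZ linB).
  rewrite !scalerDr !scalerA [c * a]mulrC.
  by rewrite -!addrA; congr (_ + _); rewrite addrCA.
exists (4 * (normc c ^+ 2 * M) + 4 * N) => f.
rewrite !fctE; apply: le_trans (sqD _ _) _.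
have a := le_trans (sqZ c (A f)) (ler_wpM2l (sqr_ge0 (normc c)) (MA f)).
by have b := NB f; lra.
Qed.

Lemma bounded_comp A B :
  bounded_operator A -> bounded_operator B -> bounded_operator (A \o B).
Proof.
move=> bA bB; have [linA _] := bA; have [linB _] := bB.
have [M M0 MA] := bounded_sqbound bA; have [N N0 NB] := bounded_sqbound bB.
apply/boundedP; split=> [a f g|]; first by rewrite /= linB linA.
exists (M * N) => f /=; apply: le_trans (MA _) _.
by rewrite -mulrA ler_wpM2l.
Qed.

Lemma bounded0 : bounded_operator (0 : H -> H).
Proof.
apply/boundedP; split=> [a f g|]; first by rewrite !op0 scaler0 addr0.
by exists 0 => f; rewrite op0 sq0 mul0r.
Qed.

Lemma boundedB A B :
  bounded_operator A -> bounded_operator B -> bounded_operator (A - B).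
Proof.
move=> bA bB; rewrite -[A]scale1r -scaleN1r.
apply: bounded_lincomb => //; rewrite -[_ *: B]addr0.
exact: bounded_lincomb bounded0.
Qed.

(** Approximation in operator norm, without the supremum. *)
Definition approximable S T :=
  forall e : R, 0 < e -> exists2 A, S A & sqbound e (T - A).

Lemma approximableP S T : S `<=` @bounded_operator R I -> bounded_operator T ->
  (forall e : R, 0 < e -> exists2 A, S A & opnorm (T - A) < e) <->
  approximable S T.
Proof.
move=> Sb bT; split=> app e e0.
  have [|A SA TA] := app (Num.sqrt e); first by rewrite sqrtr_gt0.
  exists A => //; rewrite -(sqr_sqrtr (ltW e0)); apply: opnorm_sqbound => //.
  exact: boundedB (Sb _ SA).
have [|A SA TA] := app ((e / 2) ^+ 2); first by rewrite exprn_gt0 ?divr_gt0.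
exists A => //; have [lin _] := boundedB bT (Sb _ SA).
apply: le_lt_trans (opnorm_le _ lin TA) _; first by rewrite sqr_ge0.
rewrite sqrtr_sqr ger0_norm ?divr_ge0 ?(ltW e0) //.
by rewrite ltr_pdivrMr // mulr_natr mulr2n ltrDl.
Qed.

Lemma closed_subalgebraP S :
  S `<=` @bounded_operator R I ->
  S 0 ->
  (forall (c : R[i]) A B, S A -> S B -> S (c *: A + B)) ->
  (forall A B, S A -> S B -> S (A \o B)) ->
  (forall T, bounded_operator T -> approximable S T -> S T) ->
  closed_subalgebra S.
Proof.
by move=> Sb S0 Sl Sc Sl'; split=> // T bT /(approximableP Sb bT); exact: Sl'.
Qed.

Lemma closed_bounded : closed_subalgebra (@bounded_operator R I).
Proof.
apply: closed_subalgebraP => // *;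
  [exact: bounded0 | exact: bounded_lincomb | exact: bounded_comp].
Qed.

Lemma normc_small (z : R[i]) (M : R) :
  (forall e : R, 0 < e -> normc z ^+ 2 <= e * M) -> z = 0.
Proof.
move=> zM; apply: eq0_normc; apply/eqP; rewrite -sqrf_eq0 eq_le sqr_ge0 andbT.
apply/ler_addgt0Pl => e e0; rewrite addr0.
have M0 : 0 < `|M| + 1 by rewrite ltr_wpDl.
apply: le_trans (zM (e / (`|M| + 1)) _) _; first by rewrite divr_gt0.
rewrite -mulrA ler_piMr ?(ltW e0) // mulrC ler_pdivrMr // mul1r.
by rewrite (le_trans (ler_norm M)) // lerDl.
Qed.

End Approximation.

Section TensorAlgebra.
Variables (R : realType) (G : digraph).
Local Notation C := R[i].
Local Notation V := (vertex G).
Local Notation E := (edge G).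
Local Notation H := (ell2 R (dipath G)).
Local Notation is_path := (@is_path G).
Local Notation TA := (tensor_algebra R G).
Implicit Types (h k : H) (x y z : V) (s t : seq E) (e : E) (A B T : H -> H).

Lemma TA_min (S : set (H -> H)) : closed_subalgebra S ->
  (forall e, S (Ledge e)) -> (forall x, S (Lvertex x)) -> TA `<=` S.
Proof.
move=> cS Se Sv A; apply; split=> //.
by move=> _ [[e _ <-]|[x _ <-]].
Qed.

Lemma TA_closed : closed_subalgebra TA.
Proof.
have sub S : closed_subalgebra S /\
    range (@Ledge R G) `|` range (@Lvertex R G) `<=` S -> TA `<=` S.
  by move=> HS A; apply.
split.
- apply: sub; split; first exact: closed_bounded.
  by move=> _ [[e _ <-]|[x _ <-]]; [exact: Ledge_bounded|exact: Lvertex_bounded].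
- by move=> S [[_ S0 _ _ _] _].
- by move=> c A B TA TB S HS; case: (HS.1) => _ _ L _ _; apply: L; exact: sub.
- by move=> A B TA TB S HS; case: (HS.1) => _ _ _ M _; apply: M; exact: sub.
- move=> T bT app S HS; case: (HS.1) => _ _ _ _ L; apply: L => // e e0.
  by have [A TA TAe] := app e e0; exists A => //; exact: sub TA.
Qed.

Lemma TA_edge e : TA (Ledge e).
Proof. by move=> S [_ gS]; apply: gS; left; exists e. Qed.

Lemma TA_vertex x : TA (Lvertex x).
Proof. by move=> S [_ gS]; apply: gS; right; exists x. Qed.

Lemma TA_bounded A : TA A -> bounded_operator A.
Proof. by have [b _ _ _ _] := TA_closed; exact: b. Qed.

Lemma TA_linear A : TA A -> linear A.
Proof. by move=> /TA_bounded[]. Qed.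

Lemma TA0 : TA 0. Proof. by have [_ ? _ _ _] := TA_closed. Qed.

Lemma TA_lincomb (c : C) A B : TA A -> TA B -> TA (c *: A + B).
Proof. by have [_ _ L _ _] := TA_closed; exact: L. Qed.

Lemma TA_comp A B : TA A -> TA B -> TA (A \o B).
Proof. by have [_ _ _ M _] := TA_closed; exact: M. Qed.

Lemma TAD A B : TA A -> TA B -> TA (A + B).
Proof. by move=> a b; rewrite -[A]scale1r; exact: TA_lincomb. Qed.

Lemma TAZ c A : TA A -> TA (c *: A).
Proof. by move=> a; rewrite -[_ *: _]addr0; exact: TA_lincomb TA0. Qed.

Lemma TAB A B : TA A -> TA B -> TA (A - B).
Proof. by move=> a b; apply: TAD => //; rewrite -scaleN1r; exact: TAZ. Qed.

Lemma TA_lim T : bounded_operator T -> approximable TA T -> TA T.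
Proof.
move=> bT app; have [b _ _ _ L] := TA_closed; apply: L => //.
exact/(approximableP b bT).
Qed.

Lemma TA_sum (J : Type) (r : seq J) (F : J -> H -> H) :
  (forall j, TA (F j)) -> TA (\sum_(j <- r) F j).
Proof. by move=> TF; elim/big_rec: _ => [|j A _]; [exact: TA0 | exact: TAD]. Qed.

(** ** Locality and right covariance *)

(** A coordinate of A h at a path only sees the coordinates of h at the right
factors of that path. This triangularity is closed under composition, which
avoids expanding the product of two Fourier series. *)
Definition local A := forall h y s,
  (forall s1 s2, s = s1 ++ s2 -> entry h (wsrc y s1) s2 = 0) ->
  entry (A h) y s = 0.

(** h' is obtained from h by creating the edge e on the right. *)
Definition rtrans e h' h := (forall y, entry h' y [::] = 0) /\
  forall y s e', entry h' y (rcons s e') =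
    if (e' == e) && (wsrc y s == rng e) then entry h y s else 0.

(** Left creation commutes with right creation. Stated as the preservation of a
relation, this is again closed under composition at once. *)
Definition covariant A :=
  forall e h' h, rtrans e h' h -> rtrans e (A h') (A h).

Definition good A := [/\ bounded_operator A, local A & covariant A].

Lemma approx_entry T h y s (e : R) A : sqbound e (T - A) ->
  normc (entry (T h) y s - entry (A h) y s) ^+ 2 <= e * sq h.
Proof.
move=> Te; rewrite -entryB; apply: le_trans (entry_le_sqr _ _ _) _.
by have := Te h; rewrite opB.
Qed.

Lemma closed_good : closed_subalgebra good.
Proof.
apply: closed_subalgebraP.
- by move=> A [].
- split; [exact: bounded0|by move=> *; rewrite op0 entry0|].
  by move=> e h' h _; split=> *; rewrite !op0 !entry0 ?if_same.
- move=> c A B [bA lA cA] [bB lB cB]; split; first exact: bounded_lincomb.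
    move=> h y s hs; rewrite opD opZ entryD entryZ lA // lB // mulr0 addr0 //.
  move=> e h' h r; have [a1 a2] := cA e h' h r; have [b1 b2] := cB e h' h r.
  split=> *; rewrite !opD !opZ !entryD !entryZ ?a1 ?b1 ?mulr0 ?addr0 // a2 b2.
  by case: ifP; rewrite ?mulr0 ?addr0.
- move=> A B [bA lA cA] [bB lB cB]; split; first exact: bounded_comp.
    move=> h y s hs; apply: lA => s1 s2 ss; apply: lB => t1 t2 tt.
    by rewrite -wsrc_cat; apply: hs; rewrite ss tt catA.
  by move=> e h' h r; apply: cA; exact: cB.
- move=> T bT app; split=> //.
    move=> h y s hs; apply: (@normc_small _ _ (sq h)) => e e0.
    have [A [_ lA _] TA] := app e e0.
    by have := approx_entry h y s TA; rewrite lA // subr0.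
  move=> e h' h r; split=> [y|y s e'].
    apply: (@normc_small _ _ (sq h')) => d d0.
    have [A [_ _ cA] TA] := app d d0; have [a1 _] := cA e h' h r.
    by have := approx_entry h' y [::] TA; rewrite a1 subr0.
  apply/eqP; rewrite -subr_eq0; apply/eqP.
  apply: (@normc_small _ _ (4 * sq h' + 4 * sq h)) => d d0.
  have [A [_ _ cA] TA] := app d d0; have [_ a2] := cA e h' h r.
  have := approx_entry h' y (rcons s e') TA; rewrite a2.
  case: ifP => _ le1; last first.
    rewrite subr0; rewrite subr0 in le1; apply: le_trans le1 _.
    have := sq_ge0 h; have := sq_ge0 h'; nra.
  have le2 := approx_entry h y s TA.
  set u := entry (T h') _ _ in le1 *; set v := entry (T h) _ _ in le2 *.
  set w := entry (A h) _ _ in le1 le2 *.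
  have -> : u - v = (u - w) + (- (v - w)) by ring.
  apply: le_trans (sqnormcD _ _) _; rewrite !normcZ2 normcN; nra.
Qed.

Lemma edge_good e : good (Ledge e).
Proof.
split; first exact: Ledge_bounded.
  move=> h y s hs; rewrite entry_edge; case: s hs => // e' s hs.
  case: ifP => // /andP[/eqP ee _].
  by have := hs [:: e'] s erefl; rewrite /wsrc /= ee.
move=> e' h' h [r1 r2]; split=> [y|y s f]; rewrite !entry_edge //.
case: s => [|f' s] /=; first by rewrite r1 !if_same.
rewrite r2; case: eqP => [->|_] /=; last by rewrite if_same.
by case: (y == _) => //=; rewrite if_same.
Qed.

Lemma vertex_good x : good (Lvertex x).
Proof.
split; first exact: Lvertex_bounded.
  move=> h y s hs; rewrite entry_vertex; case: ifP => // _.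
  exact: (hs [::] s).
move=> e' h' h [r1 r2]; split=> [y|y s f]; rewrite !entry_vertex ?r1 ?if_same //.
by rewrite r2; case: (y == x) => //; rewrite if_same.
Qed.

Lemma TA_good A : TA A -> good A.
Proof. by apply: TA_min; [exact: closed_good|exact: edge_good|exact: vertex_good]. Qed.

(** ** Fourier coefficients *)

(** The coefficient of A at the path with range y, source x and edges s. *)
Definition cf A x y s : C := entry (A (vac R x)) y s.

Lemma vac_rtrans e : rtrans e (Ledge e (vac R (src e))) (vac R (rng e)).
Proof.
split=> [y|y s f]; rewrite entry_edge //.
case: s => [|f' s] /=; rewrite !entry_vac.
  rewrite /wsrc /= eqxx andbT; case: eqP => //= _.
  by case: eqVneq => //= ->; rewrite eqxx.
by rewrite andbF /= if_same; case: s => [|? ?] /=; rewrite ?andbF ?if_same.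
Qed.

Lemma edge_vac0 e x : src e != x -> Ledge e (vac R x) = 0.
Proof. by move=> ex; apply: Ledge_xi0; apply/eqP. Qed.

Lemma cf_src A x y s : good A -> wsrc y s != x -> cf A x y s = 0.
Proof.
case=> _ lA _ sx; apply: lA => s1 s2 ss; rewrite entry_vac.
case: eqP => //= sx1; case: eqP => //= s20.
by case/eqP: sx; rewrite -sx1 ss s20 cats0.
Qed.

Lemma cf_nopath A x y s : ~~ is_path y s -> cf A x y s = 0.
Proof. exact: entry_nopath. Qed.

Lemma cf_edger A e x y s : good A ->
  cf (A \o Ledge e) x y s =
    if (src e == x) && (s != [::]) && (last e s == e)
    then cf A (rng e) y (take (size s).-1 s) else 0.
Proof.
move=> gA; have [bA lA cA] := gA; have [linA _] := bA.
have [<-|ex] := eqVneq (src e) x; last first.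
  by rewrite /cf /= edge_vac0 // (linop0 linA) entry0.
have [r1 r2] := cA e _ _ (vac_rtrans e).
rewrite /cf /=; case/lastP: s => [|s f] /=; first exact: r1.
rewrite r2 last_rcons size_rcons /= -cats1 take_size_cat // -/(cf A _ _ _).
have [_|ne] := eqVneq f e; rewrite /= ?andbF //.
have -> /= : s ++ [:: f] != [::] by case: s.
by case: eqP => // /eqP ne; rewrite [RHS]cf_src.
Qed.

Lemma cf_edger_rcons A e y s : good A ->
  cf (A \o Ledge e) (src e) y (rcons s e) = cf A (rng e) y s.
Proof.
move=> gA; rewrite cf_edger // eqxx last_rcons eqxx andbT size_rcons /=.
by rewrite -cats1 take_size_cat //; case: s.
Qed.

Lemma good_comp A B : good A -> good B -> good (A \o B).
Proof. by have [_ _ _ M _] := closed_good; exact: M. Qed.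

Lemma cf_wordr_cat A t x y s z : good A -> is_path z t -> wsrc z t = x ->
  cf (A \o Lword R t) x y (s ++ t) = cf A z y s.
Proof.
elim: t A x y s z => [|e t IH] A x y s z gA /=.
  by move=> _ <-; rewrite cats0.
move=> /andP[/eqP re pt] sx; have gAe := good_comp gA (edge_good e).
have -> : A \o (Ledge e \o Lword R t) = (A \o Ledge e) \o Lword R t by [].
rewrite -cat_rcons (IH _ _ _ _ (src e)) //.
by rewrite cf_edger_rcons // re.
Qed.

Lemma cf_wordr_nsuffix A t x y s : good A -> ~~ suffix t s ->
  cf (A \o Lword R t) x y s = 0.
Proof.
elim: t A x y s => [|e t IH] A x y s gA /=; first by rewrite suffix0s.
move=> ns; have gAe := good_comp gA (edge_good e).
have -> : A \o (Ledge e \o Lword R t) = (A \o Ledge e) \o Lword R t by [].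
have [/suffixP[s1 ss]|ns'] := boolP (suffix t s); last exact: IH.
have [pt|npt] := boolP (is_path (wsrc y s1) t); last first.
  rewrite ss cf_nopath // path_cat (negPf npt) andbF //.
have [sx|sx] := eqVneq (wsrc y s) x; last first.
  rewrite cf_src //; apply: good_comp => //.
  elim: t {IH ns ss pt} => [|f t IHt]; last exact: (good_comp (edge_good f)).
  by split; [|by move=> h z u hz; exact: (hz [::])|by []];
    apply/boundedP; split=> //; exists 1 => f; rewrite mul1r.
rewrite ss; have sx' : wsrc (wsrc y s1) t = x by rewrite -wsrc_cat -ss.
rewrite (cf_wordr_cat _ _ gAe pt sx') cf_edger //.
case/lastP: s1 ss ns pt {sx'} => [|s1 f] ss ns pt; first by rewrite andbF.
rewrite last_rcons; case: (eqVneq f e) => [fe|]; last by rewrite andbF.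
by rewrite ss fe cat_rcons suffix_suffix in ns.
Qed.

Lemma cf_word0 A t x : good A -> (forall x y s, cf A x y s = 0) ->
  A (Lword R t (vac R x)) = 0.
Proof.
elim: t A => [|e t IH] A gA A0 /=.
  by apply: entry_ext => y s; rewrite entry0; exact: A0.
apply: (IH (A \o Ledge e)); first exact: good_comp (edge_good e).
by move=> z y s; rewrite cf_edger // A0 if_same.
Qed.

(** Locality makes this a finite computation: for a single coordinate, h may be
replaced by a finite combination of creations on vacuum vectors, and covariance
determines A there. *)
Lemma good_cf0 A : good A -> (forall x y s, cf A x y s = 0) -> A = 0.
Proof.
move=> gA A0; apply/funext => h; apply: entry_ext => y s.
rewrite op0 entry0; have [bA lA _] := gA; have [linA _] := bA.
have [ps|ps] := boolP (is_path y s); last by rewrite entry_nopath.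
(* remove from h its components on the finitely many suffixes of s *)
pose h' := \sum_(0 <= i < (size s).+1)
  entry h (wsrc y (take i s)) (drop i s) *:
    Lword R (drop i s) (vac R (wsrc y s)).
have Ah' : A h' = 0.
  rewrite (linop_sum linA) big1 // => i _.
  by rewrite (linopZ linA) cf_word0 // scaler0.
have -> : A h = A (h - h') by rewrite (linopB linA) Ah' subr0.
apply: lA => s1 s2 ss; rewrite entryB; apply/eqP; rewrite subr_eq0; apply/eqP.
have le1 : (size s1 < (size s).+1)%N by rewrite ltnS ss size_cat leq_addr.
have t1 : take (size s1) s = s1 by rewrite ss take_size_cat.
have d1 : drop (size s1) s = s2 by rewrite ss drop_size_cat.
rewrite entry_sum (bigD1_seq (size s1)) ?iota_uniq ?mem_index_iota //=.
rewrite entryZ t1 d1 -[X in entry (Lword R s2 _) _ X]cats0 entry_word_cat.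
  rewrite entry_vac -wsrc_cat -ss !eqxx /= mulr1 big_seq_cond big1 ?addr0 //.
  move=> i; rewrite mem_index_iota ltnS => /andP[/= i_s ni].
  rewrite entryZ entry_word; case: ifP => [|_]; last by rewrite mulr0.
  case/andP=> /prefixP[u uE] _; rewrite entry_vac.
  suff -> : (drop (size (drop i s)) s2 == [::]) = false.
    by rewrite andbF mulr0.
  apply: contraNF ni => /eqP d0.
  have u0 : u = [::] by move: d0; rewrite uE drop_size_cat.
  have := congr1 size uE; rewrite u0 cats0 size_drop => sz.
  by apply/eqP; apply: (@addIn (size s2)); rewrite -size_cat -ss sz subnKC.
by move: ps; rewrite ss path_cat => /andP[].
Qed.

End TensorAlgebra.

Section Division.
Variables (R : realType) (G : digraph).
Local Notation C := R[i].
Local Notation V := (vertex G).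
Local Notation E := (edge G).
Local Notation H := (ell2 R (dipath G)).
Local Notation is_path := (@is_path G).
Local Notation TA := (tensor_algebra R G).
Implicit Types (h k : H) (x y z : V) (s t : seq E) (e : E) (A B T X Y : H -> H).

Lemma cfD A B x y s : cf (A + B) x y s = cf A x y s + cf B x y s.
Proof. exact: entryD. Qed.

Lemma cfZ (c : C) A x y s : cf (c *: A) x y s = c * cf A x y s.
Proof. exact: entryZ. Qed.

Lemma cfB A B x y s : cf (A - B) x y s = cf A x y s - cf B x y s.
Proof. exact: entryB. Qed.

Lemma cf0 x y s : cf (0 : H -> H) x y s = 0.
Proof. exact: entry0. Qed.

(** The constant term is multiplicative, because the empty word has only itself
as right factor. *)
Lemma entry_nil A h x : good A ->
  entry (A h) x [::] = cf A x x [::] * entry h x [::].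
Proof.
case=> -[linA _] lA _; set c := entry h x [::].
suff : entry (A (h - c *: vac R x)) x [::] = 0.
  rewrite (linopB linA) (linopZ linA) entryB entryZ => /eqP.
  by rewrite subr_eq0 => /eqP ->; rewrite mulrC.
apply: lA => -[|//] [|//] _; rewrite /wsrc /= entryB entryZ entry_vac !eqxx.
by rewrite mulr1 subrr.
Qed.

(** Left division by the edge e. The adjoint of a creation operator does not lie
in the algebra, so the constant term has to be removed first. *)
Definition divide e X : H -> H :=
  fun h => adj (rng e) [:: e] (X h - cf X (rng e) (rng e) [::] *: h).

Lemma edge_path e : is_path (rng e) [:: e].
Proof. by rewrite /= eqxx. Qed.

Lemma divideE e X h : divide e X h =
  adj (rng e) [:: e] (X h) - cf X (rng e) (rng e) [::] *: adj (rng e) [:: e] h.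
Proof.
have lin := @adj_linear R G (rng e) [:: e].
by rewrite /divide (linopB lin) (linopZ lin).
Qed.

Lemma divide_lincomb e (c : C) A B :
  divide e (c *: A + B) = c *: divide e A + divide e B.
Proof.
apply/funext => h; rewrite opD opZ !divideE opD opZ cfD cfZ.
have lin := @adj_linear R G (rng e) [:: e].
rewrite (linopD lin) (linopZ lin) scalerBr scalerDl scalerA.
by rewrite opprD addrACA.
Qed.

(** A twisted Leibniz rule, which makes stability under left division pass to
products. *)
Lemma divide_comp e A B : good A -> good B ->
  divide e (A \o B) =
    divide e A \o B + cf A (rng e) (rng e) [::] *: divide e B.
Proof.
move=> gA gB; apply/funext => h; rewrite opD opZ /= !divideE /=.
have -> : cf (A \o B) (rng e) (rng e) [::] =
    cf A (rng e) (rng e) [::] * cf B (rng e) (rng e) [::].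
  by rewrite {1}/cf /= entry_nil.
by rewrite scalerBr scalerA addrA subrK.
Qed.

Lemma divide0 e : divide e 0 = 0.
Proof.
apply/funext => h; rewrite divideE cf0 scale0r subr0.
by rewrite op0 (linop0 (@adj_linear R G _ _)).
Qed.

Lemma divide_edge e f :
  divide e (Ledge f) = if f == e then Lvertex (src e) else 0.
Proof.
apply/funext => h; apply: entry_ext => y s.
rewrite divideE entryB entryZ /cf entry_edge mul0r subr0.
rewrite entry_adj ?edge_path // entry_edge /= /wsrc /= [f == e]eq_sym.
case: (eqVneq e f) => [<-|_]; first by rewrite entry_vertex eqxx; case: eqP => [->|].
by rewrite op0 entry0 if_same.
Qed.

Lemma divide_vertex e x : divide e (Lvertex x) = 0.
Proof.
apply/funext => h; apply: entry_ext => y s.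
rewrite divideE entryB entryZ op0 entry0 !entry_adj ?edge_path //.
case: ifP => _; last by rewrite mulr0 subrr.
rewrite /cf !entry_vertex entry_vac !eqxx /=.
by case: ifP => _; rewrite ?mul1r ?mul0r subrr.
Qed.

Lemma divide_sq e T A (d : R) : 0 <= d -> sqbound d (T - A) ->
  sqbound (4 * d + 4 * (d * sq (vac R (rng e)))) (divide e T - divide e A).
Proof.
move=> d0 TA h; have lin := @adj_linear R G (rng e) [:: e].
rewrite opB /divide -(linopB lin); apply: le_trans (sq_adj _ _ _) _.
set a := cf T _ _ _; set b := cf A _ _ _.
have -> : T h - a *: h - (A h - b *: h) = (T - A) h - (a - b) *: h.
  by rewrite opB scalerBl !opprB addrACA [RHS]addrACA [- (a *: h) - _]addrC.
apply: le_trans (sqB _ _) _.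
have ab : normc (a - b) ^+ 2 <= d * sq (vac R (rng e)).
  rewrite /a /b -cfB; apply: le_trans (entry_le_sqr _ _ _) _; exact: TA.
have := sqZ (a - b) h; have := TA h.
have := ler_wpM2r (sq_ge0 h) ab; lra.
Qed.

Lemma TA_divide e X : TA X -> TA (divide e X).
Proof.
suff : TA `<=` [set X | TA X /\ TA (divide e X)] by move=> sub /sub[].
apply: TA_min; last 2 first.
- move=> f /=; split; first exact: TA_edge.
  by rewrite divide_edge; case: ifP => _; [exact: TA_vertex|exact: TA0].
- by move=> x /=; split; [exact: TA_vertex|rewrite divide_vertex; exact: TA0].
apply: closed_subalgebraP.
- by move=> A [/TA_bounded].
- by split; [exact: TA0|rewrite divide0; exact: TA0].
- move=> c A B [TA' TdA] [TB TdB]; split; first exact: TA_lincomb.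
  by rewrite divide_lincomb; exact: TA_lincomb.
- move=> A B [TA' TdA] [TB TdB]; split; first exact: TA_comp.
  rewrite divide_comp; [|exact: TA_good..].
  by apply: TAD; [exact: TA_comp|exact: TAZ].
- move=> T bT app.
  have TT : TA T by apply: TA_lim => // d /app[A [TA' _] TAd]; exists A.
  split=> //; apply: TA_lim.
    apply/boundedP; split=> [c h k|].
      have lin := @adj_linear R G (rng e) [:: e].
      rewrite !divideE (TA_linear TT) (linopD lin) (linopZ lin).
      rewrite [adj _ _ (c *: h + k)](linopD lin) (linopZ lin).
      rewrite scalerDr scalerBr !scalerA [c * _]mulrC opprD.
      by rewrite addrACA.
    have [M M0 TM] := bounded_sqbound bT.
    eexists => h; have := @divide_sq e T 0 M M0.
    by rewrite subr0 divide0 subr0; apply.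
  set K := sq (vac R (rng e)) => d d0.
  have K0 : 0 < 4 + 4 * K by have := sq_ge0 (vac R (rng e)); rewrite -/K; lra.
  have [|A [TA' TdA] TAd] := app (d / (4 + 4 * K)); first by rewrite divr_gt0.
  exists (divide e A) => // h.
  apply: le_trans (@divide_sq e _ _ _ _ TAd h) _; first by rewrite divr_ge0 ?ltW.
  rewrite -/K; set D := d / _; suff -> : 4 * D + 4 * (D * K) = d by [].
  by rewrite /D; field; apply: lt0r_neq0.
Qed.

Lemma cf_divide e X x y s : cf (divide e X) x y s =
  if y == src e then cf X x (rng e) (e :: s) else 0.
Proof.
rewrite {1}/cf divideE entryB entryZ !entry_adj ?edge_path //.
case: ifP => _; last by rewrite mulr0 subr0.
by rewrite entry_vac andbF mulr0 subr0.
Qed.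

Lemma left_division t z X : is_path z t -> TA X ->
  exists2 Y, TA Y & forall x y s,
    cf Y x y s = if y == wsrc z t then cf X x z (t ++ s) else 0.
Proof.
elim: t z X => [|e t IH] z X /=.
  move=> _ TX; exists (Lvertex z \o X); first by apply: TA_comp => //; exact: TA_vertex.
  by move=> x y s; rewrite /cf /= entry_vertex /wsrc /=; case: eqP => [->|].
move=> /andP[/eqP <- pt] TX.
have [Y TY YE] := IH _ _ pt (TA_divide e TX); exists Y => // x y s.
by rewrite YE cf_divide eqxx.
Qed.

Lemma TA_word t : t != [::] -> TA (Lword R t).
Proof.
elim: t => //= e [|f t] IH _; last by apply: TA_comp (IH isT); exact: TA_edge.
exact: TA_edge.
Qed.

End Division.

(** * Geometric series in the algebra *)

Section Series.
Variables (R : realType) (G : digraph).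
Local Notation C := R[i].
Local Notation E := (edge G).
Local Notation H := (ell2 R (dipath G)).
Local Notation TA := (tensor_algebra R G).
Variables (d v : seq E) (A : nat -> H -> H).
Hypotheses (d0 : d != [::]) (v0 : v != [::]).
Hypotheses (TA_A : forall i, TA (A i)) (A1 : forall i h, sq (A i h) <= sq h).
Implicit Types (h : H) (i n m : nat).

Let c : C := (4^-1)%:C.

Lemma normc_quarter : normc c ^+ 2 = 16^-1.
Proof. by rewrite /c normc_real ?invr_ge0 //; field. Qed.

(** Partial sums of the series of the 4^-k L_v^k L_d A_(i+k). The index i makes
the recursion B_i = L_d A_i + (1/4) L_v B_(i+1) available for the limit. *)
Fixpoint psum n i : H -> H := if n is n'.+1
  then c *: (Lword R v \o psum n' i.+1) + (Lword R d \o A i) else 0.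

Lemma psum0 i h : psum 0 i h = 0. Proof. by []. Qed.

Lemma psumS n i h :
  psum n.+1 i h = c *: Lword R v (psum n i.+1 h) + Lword R d (A i h).
Proof. by []. Qed.

Lemma TA_psum n i : TA (psum n i).
Proof.
elim: n i => [|n IH] i; first exact: TA0.
by apply: TA_lincomb; apply: TA_comp => //; exact: TA_word.
Qed.

(** The bound 8 solves 4 + 4 * (1/16) * M <= M. *)
Lemma sq_psum n i h : sq (psum n i h) <= 8 * sq h.
Proof.
elim: n i => [|n IH] i; first by rewrite psum0 sq0 mulr_ge0 ?sq_ge0.
rewrite psumS; apply: le_trans (sqD _ _) _.
have a := sqZ c (Lword R v (psum n i.+1 h)); rewrite normc_quarter in a.
have := sq_word v (psum n i.+1 h); have := sq_word d (A i h).
have := A1 i h; have := IH i.+1; have := sq_ge0 h; lra.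
Qed.

Lemma psum_tail n m i h :
  sq (psum (n + m) i h - psum n i h) <= 16^-1 ^+ n * (8 * sq h).
Proof.
elim: n i => [|n IH] i.
  by rewrite expr0 mul1r psum0 subr0 add0n sq_psum.
rewrite addSn !psumS opprD addrACA subrr addr0 -scalerBr.
rewrite -(linopB (@Lword_linear R G v)).
apply: le_trans (sqZ _ _) _; rewrite normc_quarter exprS -mulrA.
rewrite ler_wpM2l ?invr_ge0 //.
exact: le_trans (sq_word _ _) (IH _).
Qed.

(** The k-th term lives on words of length at least k, so that the limit can be
taken one coordinate at a time. *)
Lemma psum_stable n m i h y s : (size s < n)%N ->
  entry (psum (n + m) i h) y s = entry (psum n i h) y s.
Proof.
elim: n i y s => [//|n IH] i y s sn.
rewrite addSn !psumS !entryD !entryZ; congr (_ * _ + _).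
rewrite !entry_word; case: ifP => // /andP[/prefixP[u su] _].
apply: IH; rewrite su drop_size_cat //; move: sn; rewrite su size_cat.
by case: (v) v0 => // e t _; rewrite ltnS /= addSn; apply: leq_trans; rewrite ltnS leq_addl.
Qed.

Definition series_coef i h : dipath G -> C :=
  fun w => psum (size (pedges w)).+1 i h w.

Lemma series_coefE i h w n : (size (pedges w) < n)%N ->
  series_coef i h w = psum n i h w.
Proof.
move=> wn; rewrite /series_coef -!entry_path -(subnK wn) addnC psum_stable //.
Qed.

Lemma long_enough (W : seq (dipath G)) :
  exists N, forall w, w \in W -> (size (pedges w) < N)%N.
Proof.
exists (\sum_(w <- W) size (pedges w)).+1 => w wW.
by rewrite ltnS (big_rem _ wW) /= leq_addr.
Qed.

Lemma series_coef_sum i h (W : seq (dipath G)) : uniq W ->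
  \sum_(w <- W) normc (series_coef i h w) ^+ 2 <= 8 * sq h.
Proof.
move=> uW; have [N WN] := long_enough W.
apply: le_trans (sq_psum N i h); apply: le_trans (sum_le_sq _ uW).
rewrite big_seq [leRHS]big_seq; apply: ler_sum => w wW.
by rewrite (series_coefE _ _ (WN w wW)).
Qed.

Definition series i h : H := Ell2 (ell2P (@series_coef_sum i h)).

Lemma sq_series i h : sq (series i h) <= 8 * sq h.
Proof. by apply: sq_le => W; exact: series_coef_sum. Qed.

Lemma entry_series i h y s n : (size s < n)%N ->
  entry (series i h) y s = entry (psum n i h) y s.
Proof.
move=> sn; rewrite /entry; case: insubP => // w _ wE.
by rewrite /= (@series_coefE _ _ _ n) // /pedges wE.
Qed.

Lemma seriesE i h :
  series i h = c *: Lword R v (series i.+1 h) + Lword R d (A i h).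
Proof.
apply: entry_ext => y s; rewrite (@entry_series _ _ _ _ (size s).+2) //.
rewrite psumS !entryD !entryZ !entry_word; congr (_ * _ + _).
case: ifP => // _; rewrite (@entry_series _ _ _ _ (size s).+1) //.
by rewrite ltnS size_drop leq_subr.
Qed.

Lemma TA_series i : TA (series i).
Proof.
apply: TA_lim.
  apply/boundedP; split; last by exists 8 => h; exact: sq_series.
  move=> a h k; apply: entry_ext => y s; have lin := TA_linear (TA_psum (size s).+1 i).
  rewrite entryD entryZ !(@entry_series _ _ _ _ (size s).+1) //.
  by rewrite lin entryD entryZ.
move=> e e0.
have [n ne] : exists n, 16^-1 ^+ n * 8 <= e.
  have e8 : 0 < e / 8 by rewrite divr_gt0.
  have [n _ /= hn] := @near_infty_natSinv_lt R (PosNum e8).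
  exists n.+1; rewrite -ler_pdivlMr //; apply: le_trans _ (ltW (hn n (leqnn n))).
  rewrite exprVn lef_pV2 ?posrE ?exprn_gt0 ?ltr0n //.
  rewrite -natrX ler_nat ltnW //; exact: ltn_expl.
exists (psum n i) => [|h]; first exact: TA_psum.
apply: le_trans (_ : 16^-1 ^+ n * (8 * sq h) <= _); last first.
  by rewrite mulrA ler_wpM2r ?sq_ge0.
apply: sq_le => W uW; have [N WN] := long_enough W.
apply: le_trans (psum_tail n N i h); apply: le_trans (sum_le_sq _ uW).
rewrite big_seq [leRHS]big_seq; apply: ler_sum => w wW.
rewrite opB !ell2D !ell2N /= (@series_coefE i h w (n + N)) //.
by rewrite (leq_trans (WN w wW)) // leq_addl.
Qed.

End Series.

(** * Automatic continuity *)

Section Continuity.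
Variables (R : realType) (G : digraph).
Local Notation C := R[i].
Local Notation V := (vertex G).
Local Notation E := (edge G).
Local Notation H := (ell2 R (dipath G)).
Local Notation is_path := (@is_path G).
Local Notation TA := (tensor_algebra R G).
Variable delta : (H -> H) -> (H -> H).
Hypothesis der : derivation TA delta.

Lemma der_TA A : TA A -> TA (delta A).
Proof. by have [d1 _ _] := der; exact: d1. Qed.

Lemma der_lincomb (c : C) A B : TA A -> TA B ->
  delta (c *: A + B) = c *: delta A + delta B.
Proof. by have [_ d2 _] := der; exact: d2. Qed.

Lemma der_comp A B : TA A -> TA B ->
  delta (A \o B) = (delta A \o B) + (A \o delta B).
Proof. by have [_ _ d3] := der; exact: d3. Qed.

Lemma der0 : delta 0 = 0.
Proof. by have := der_lincomb (-1) (@TA0 R G) (@TA0 R G); rewrite scaler0 addr0 scaleN1r addNr. Qed.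

Lemma derD A B : TA A -> TA B -> delta (A + B) = delta A + delta B.
Proof. by move=> a b; have := der_lincomb 1 a b; rewrite !scale1r. Qed.

Lemma derZ (c : C) A : TA A -> delta (c *: A) = c *: delta A.
Proof. by move=> a; have := der_lincomb c a (@TA0 R G); rewrite der0 !addr0. Qed.

Lemma derB A B : TA A -> TA B -> delta (A - B) = delta A - delta B.
Proof.
move=> a b; have b1 : TA (-1 *: B) by apply: TAZ.
by rewrite -scaleN1r (derD a b1) (derZ _ b) scaleN1r.
Qed.

(** A gliding hump along the recursion of [series]: the words v = g1 q and
d = g2 a create orthogonal ranges, so that their adjoints separate the two
summands of delta (B_i), up to an error bounded in i. *)
Lemma continuity_at z g1 g2 q a h : g1 != g2 ->
  is_path z (g1 :: q) -> wsrc z (g1 :: q) = z -> is_path z (g2 :: a) ->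
  exists K : R, forall A, TA A -> (forall k, sq (A k) <= sq k) ->
    sq (Lvertex (wsrc z (g2 :: a)) (delta A h)) <= K.
Proof.
move=> g12 pv sv pd; set x := wsrc z (g2 :: a).
set v := g1 :: q in pv sv *; set d := g2 :: a in pd x *.
apply: contrapT => unbounded.
have big (K : R) : exists A,
    [/\ TA A, forall k, sq (A k) <= sq k & K < sq (Lvertex x (delta A h))].
  apply: contrapT => nA; apply: unbounded; exists K => A TA' A1.
  by rewrite leNgt; apply/negP => KA; apply: nA; exists A.
(* 64 is the growth rate of delta (B_i) obtained in [step] *)
have /choice[A AP] : forall i : nat, exists A,
    [/\ TA A, forall k, sq (A k) <= sq k &
        4 * 64 ^+ i * i%:R < sq (Lvertex x (delta A h))].
  by move=> i; exact: big.
have TA_A i : TA (A i) by have [] := AP i.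
have A1 i k : sq (A i k) <= sq k by have [_ + _] := AP i; apply.
have v0 : v != [::] by []. have d0 : d != [::] by [].
pose B := series d v0 A1.
have TA_B i : TA (B i) by exact: TA_series.
have TLv : TA (Lword R v) by exact: TA_word.
have TLd : TA (Lword R d) by exact: TA_word.
have [M1 M10 bd] := bounded_sqbound (TA_bounded (der_TA TLd)).
have [M2 M20 bv] := bounded_sqbound (TA_bounded (der_TA TLv)).
pose c : C := (4^-1)%:C.
pose r i := c *: delta (Lword R v) (B i.+1 h) + delta (Lword R d) (A i h).
have linv := @Lword_linear R G v; have lind := @Lword_linear R G d.
have dB i : delta (B i) h =
    (c *: Lword R v (delta (B i.+1) h) + Lword R d (delta (A i) h)) + r i.
  have -> : B i = c *: (Lword R v \o B i.+1) + (Lword R d \o A i).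
    by apply/funext => k; exact: seriesE.
  have TvB := TA_comp TLv (TA_B i.+1); have TdA := TA_comp TLd (TA_A i).
  rewrite (der_lincomb c TvB TdA) (der_comp TLv (TA_B i.+1)).
  rewrite (der_comp TLd (TA_A i)).
  by rewrite !opD !opZ !opD /= scalerDr /r addrACA addrC.
pose K := 4 * (16^-1 * (M2 * (8 * sq h))) + 4 * (M1 * sq h).
have rK i : sq (r i) <= K.
  apply: le_trans (sqD _ _) _; rewrite /K.
  have b1 : sq (delta (Lword R v) (B i.+1 h)) <= M2 * (8 * sq h).
    apply: le_trans (bv _) _; rewrite ler_wpM2l //; exact: sq_series.
  have b2 : sq (delta (Lword R d) (A i h)) <= M1 * sq h.
    by apply: le_trans (bd _) _; rewrite ler_wpM2l.
  have := sqZ c (delta (Lword R v) (B i.+1 h)); rewrite normc_quarter; lra.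
have K0 : 0 <= K by exact: le_trans (sq_ge0 _) (rK 0%N).
pose t i := sq (Lvertex z (delta (B i) h)).
have adjB i w : sq (adj z w (delta (B i) h - r i)) <= 4 * t i + 4 * K.
  have lin := @adj_linear R G z w; rewrite (linopB lin).
  apply: le_trans (sqB _ _) _; rewrite lerD // ler_wpM2l //.
    by rewrite -adj_vertex; exact: sq_adj.
  exact: le_trans (sq_adj _ _ _) (rK i).
have adj0 f e u w k : f != e -> is_path z (e :: w) ->
    adj z (e :: w) (Lword R (f :: u) k) = 0.
  move=> fe pw; apply: entry_ext => y s; rewrite entry_adj // entry0.
  case: ifP => // _; rewrite entry_word.
  by have -> : prefix (f :: u) ((e :: w) ++ s) = false by rewrite /= (negPf fe).
have step i : t i.+1 <= 64 * (t i + K).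
  have adjE : adj z v (delta (B i) h - r i) =
      c *: Lvertex z (delta (B i.+1) h).
    have lin := @adj_linear R G z v.
    rewrite dB addrK (linopD lin) (linopZ lin) adj_word // sv.
    by rewrite [X in _ + X]adj0 ?addr0 // eq_sym.
  have t4 : Lvertex z (delta (B i.+1) h) = 4%:C *: adj z v (delta (B i) h - r i).
    by rewrite adjE scalerA -rmorphM mulfV ?rmorph1 ?scale1r // pnatr_eq0.
  have n4 : normc (4%:C : C) ^+ 2 = 16.
    by rewrite normc_real //; ring.
  rewrite /t t4; apply: le_trans (sqZ _ _) _; rewrite n4.
  have := adjB i v; rewrite -/(t i); lra.
have growth i : t i + 2 * K <= 64 ^+ i * (t 0%N + 2 * K).
  elim: i => [|i IH]; first by rewrite expr0 mul1r.
  by rewrite exprS -mulrA; have := step i; lra.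
have bound i : i%:R < t 0%N + 2 * K.
  have [_ _] := AP i.
  have adjE : adj z d (delta (B i) h - r i) = Lvertex x (delta (A i) h).
    have lin := @adj_linear R G z d.
    rewrite dB addrK (linopD lin) (linopZ lin) [adj z d (Lword R d _)]adj_word //.
    by rewrite adj0 // scaler0 add0r.
  rewrite -adjE => lt; have := adjB i d; have := growth i => gi ai.
  have p : 0 < 64 ^+ i :> R by rewrite exprn_gt0.
  rewrite -(ltr_pM2l p); lra.
have := bound (Num.truncn (t 0%N + 2 * K)).+1; apply/negP.
by rewrite -leNgt ltW // truncnS_gt.
Qed.

End Continuity.

(** * Words with a letter that occurs once *)

Section WordCombinatorics.
Variable E : eqType.
Implicit Types (f g : E) (a s t u v w c : seq E).

Lemma cat_cancelr s t u : s ++ u = t ++ u -> s = t.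
Proof.
move=> /[dup] /(congr1 size); rewrite !size_cat => /eqP; rewrite eqn_add2r.
by move=> /eqP st /eqP; rewrite eqseq_cat // => /andP[/eqP].
Qed.

Lemma last_letter f s t u w : f \notin u -> f \notin w ->
  s ++ f :: u = t ++ f :: w -> s = t /\ u = w.
Proof.
elim: s t => [|x s IH] [|y t] fu fw //=.
- by case.
- by case=> _ uE; rewrite uE mem_cat mem_head orbT in fu.
- by case=> _ wE; rewrite -wE mem_cat mem_head orbT in fw.
- by case=> -> /IH - /(_ fu fw)[-> ->].
Qed.

Lemma suffix_last_letter f s u v : f \notin u -> f \notin v ->
  suffix (f :: v) (s ++ f :: u) -> u = v.
Proof. by move=> fu fv /suffixP[t] /(last_letter fu fv)[]. Qed.

Lemma split_last f s : f \in s ->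
  exists s1 s2, s = s1 ++ f :: s2 /\ f \notin s2.
Proof.
elim: s => //= x s IH; rewrite inE.
have [fs _|fs] := boolP (f \in s).
  by have [s1 [s2 [-> n2]]] := IH fs; exists (x :: s1), s2.
by rewrite orbF => /eqP <-; exists [::], s.
Qed.

Fixpoint wpow v n := if n is n'.+1 then v ++ wpow v n' else [::].

Lemma wpowD v m n : wpow v (m + n) = wpow v m ++ wpow v n.
Proof. by elim: m => //= m ->; rewrite catA. Qed.

Lemma wpowSr v n : wpow v n.+1 = wpow v n ++ v.
Proof. by rewrite -addn1 wpowD /= cats0. Qed.

(** The second occurrence of f in the right-hand word comes after u, hence v
cannot reach beyond u. *)
Lemma prefix_fresh f u v n : f \notin v ->
  prefix (f :: v) ((f :: u) ++ wpow (f :: v) n) -> prefix v u.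
Proof.
move=> fv /=; rewrite eqxx /=; case: n => [|n] /=; first by rewrite cats0.
case/prefixP => t uE; have [vu|uv] := leqP (size v) (size u).
  apply/prefixP; exists (drop (size v) u).
  have := congr1 (take (size v)) uE; rewrite takel_cat // take_size_cat // => vE.
  by rewrite -{1}[u](cat_take_drop (size v)) vE.
have := congr1 (take (size v)) uE; rewrite [RHS]take_size_cat // take_cat.
rewrite ltnNge (ltnW uv) /= => vE; case/negP: fv; rewrite -vE mem_cat.
by move: uv; rewrite -subn_gt0; case: (_ - _)%N => //= k _; rewrite mem_head orbT.
Qed.

(** Compare the first occurrences of g on both sides. *)
Lemma prefix_shift g w c : g \in c -> g \notin w -> prefix c (w ++ c) -> w = [::].
Proof.
move=> gc gw /prefixP[t /(congr1 (index g))].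
rewrite !index_cat gc (negPf gw) => /eqP.
by rewrite -{2}[index g c]add0n eqn_add2r size_eq0 => /eqP.
Qed.

Lemma prefix_short a w c :
  prefix a (w ++ c) -> (size a <= size w)%N -> prefix a w.
Proof. by rewrite !prefixE => + aw; rewrite takel_cat. Qed.

Lemma prefix_closing g a w c :
  g \in c -> g \notin w -> prefix (a ++ c) (w ++ c) -> w = a.
Proof.
move=> gc gw pre; have aw : (size a <= size w)%N.
  by have := size_prefix pre; rewrite !size_cat leq_add2r.
have /prefixP[r wE] := prefix_short (prefix_trans (prefix_prefix a c) pre) aw.
move: pre; rewrite wE -catA prefix_catr // eqxx /= => pre.
rewrite (prefix_shift gc _ pre) ?cats0 //.
by apply: contra gw; rewrite wE mem_cat orbC => ->.
Qed.

End WordCombinatorics.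

(** * Test elements *)

Section Tests.
Variables (R : realType) (G : digraph).
Local Notation C := R[i].
Local Notation V := (vertex G).
Local Notation E := (edge G).
Local Notation H := (ell2 R (dipath G)).
Local Notation is_path := (@is_path G).
Local Notation TA := (tensor_algebra R G).
Local Notation L := (@Lword R G).
Variable delta : (H -> H) -> (H -> H).
Hypothesis der : derivation TA delta.
Hypothesis TA_id : TA id.
Hypothesis cont : forall z h, exists K : R, forall A, TA A ->
  (forall k, sq (A k) <= sq k) -> sq (Lvertex z (delta A h)) <= K.
Implicit Types (h k : H) (x y z : V) (s t u v a b c w : seq E) (e f g : E).

Lemma TA_words t : TA (L t).
Proof. by case: t => [|e t]; [exact: TA_id|exact: TA_word]. Qed.

Lemma L_cat s t : L (s ++ t) = L s \o L t.
Proof. by apply/funext => h; rewrite Lword_cat. Qed.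

Lemma delta_good t : good (delta (L t)).
Proof. by apply: TA_good; apply: (der_TA der); apply: TA_words. Qed.

Lemma delta_id : delta id = 0.
Proof.
have dE := der_comp der TA_id TA_id; apply/funext => h.
have : delta id h = delta id h + delta id h := congr1 (fun T => T h) dE.
by move=> /eqP; rewrite -subr_eq subrr eq_sym => /eqP.
Qed.

Lemma delta_cat s t :
  delta (L (s ++ t)) = (delta (L s) \o L t) + (L s \o delta (L t)).
Proof. by rewrite L_cat (der_comp der (TA_words s) (TA_words t)). Qed.

Lemma loop_pow z v n : is_path z v -> wsrc z v = z ->
  is_path z (wpow v n) /\ wsrc z (wpow v n) = z.
Proof.
move=> pv sv; elim: n => //= n [pn sn].
by rewrite path_cat wsrc_cat sv pv sn pn.
Qed.

Lemma cf_wordl_cat A t x y s : is_path y t ->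
  cf (L t \o A) x y (t ++ s) = cf A x (wsrc y t) s.
Proof. exact: entry_word_cat. Qed.

Lemma cf_wordl_nprefix A t x y s : ~~ prefix t s -> cf (L t \o A) x y s = 0.
Proof. by move=> ts; rewrite /cf /= entry_word (negPf ts). Qed.

Lemma archi_bound (r K : R) : 0 <= r -> (forall n, n%:R * r <= K) -> r = 0.
Proof.
move=> r0 rK; apply/eqP; rewrite eq_le r0 andbT leNgt; apply/negP => rp.
have := rK (Num.truncn (K / r)).+1; apply/negP; rewrite -ltNge.
by rewrite -ltr_pdivrMr // truncnS_gt.
Qed.

Lemma normc_sq0 (a : C) : normc a ^+ 2 = 0 -> a = 0.
Proof. by move/eqP; rewrite sqrf_eq0 => /eqP/eq0_normc. Qed.

Section Loop.
Variables (z : V) (v : seq E).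
Hypotheses (pv : is_path z v) (sv : wsrc z v = z).

Lemma power_bound : exists K : R, forall n (W : seq (seq E)), uniq W ->
  \sum_(s <- W) normc (cf (delta (L (wpow v n))) z z s) ^+ 2 <= K.
Proof.
have [K HK] := cont z (vac R z); exists K => n W uW.
have := HK _ (TA_words (wpow v n)) (@sq_word R G _).
apply: le_trans; apply: le_trans (sum_entry_le_sq _ z uW).
by apply: ler_sum => s _; rewrite entry_vertex eqxx.
Qed.

(** At the word v^n all n terms of the Leibniz rule contribute the same
coefficient. *)
Lemma cf_power_diag n :
  cf (delta (L (wpow v n))) z z (wpow v n) = n%:R * cf (delta (L v)) z z v.
Proof.
elim: n => [|n IH]; first by rewrite /= delta_id cf0 mul0r.
rewrite [wpow v n.+1]/= delta_cat cfD cf_wordl_cat // sv IH.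
have [pn sn] := loop_pow n pv sv.
by rewrite (cf_wordr_cat _ _ (delta_good v) pn sn) -natr1 mulrDl mul1r addrC.
Qed.

Lemma delta_loop_diag : cf (delta (L v)) z z v = 0.
Proof.
apply: normc_sq0; have [K HK] := power_bound.
apply: (@archi_bound _ K) => [|n]; first exact: sqr_ge0.
have := HK n [:: wpow v n] isT; rewrite big_seq1 cf_power_diag normcM exprMn.
apply: le_trans; rewrite ler_wpM2r ?sqr_ge0 //.
by rewrite normc_nat -natrX ler_nat; case: n => // n; rewrite expnS leq_pmulr // expn_gt0.
Qed.

Variable u : seq E.
Hypothesis nsuf : forall p, ~~ suffix v (wpow v p.+1 ++ u).
Hypothesis npre : forall q, ~~ prefix v (u ++ wpow v q).

(** At the word v^p u v^q only one term of the Leibniz rule contributes, because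
the other ones would need some v^p u ending with v or some u v^q starting with
v. *)
Lemma cf_power p q :
  cf (delta (L (wpow v (p + q).+1))) z z (wpow v p ++ u ++ wpow v q) =
    cf (delta (L v)) z z u.
Proof.
elim: p => [|p IH].
  rewrite add0n [wpow v q.+1]/= delta_cat cfD [wpow v 0]/= cat0s.
  have [pq sq] := loop_pow q pv sv.
  rewrite (cf_wordr_cat _ _ (delta_good v) pq sq) cf_wordl_nprefix ?addr0 //.
rewrite addSn [wpow v (p + q).+2]/= delta_cat cfD.
rewrite [wpow v p.+1]/= -catA cf_wordl_cat // sv.
rewrite -[v ++ wpow v (p + q)]/(wpow v (p + q).+1) IH.
rewrite cf_wordr_nsuffix ?add0r //; first exact: delta_good.
apply/negP => /suffixP[r rE]; move/negP: (nsuf p); apply.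
move: rE; rewrite -addSn wpowD wpowSr !catA => /cat_cancelr rE.
by apply/suffixP; exists (r ++ wpow v p); rewrite -rE -wpowSr.
Qed.

(** The n words v^p u v^q with p + q = n - 1 are distinct and carry the same
coefficient, while the sum of the squared coefficients is bounded in n. *)
Lemma delta_loop_coef : cf (delta (L v)) z z u = 0.
Proof.
apply: normc_sq0; have [K HK] := power_bound.
apply: (@archi_bound _ K) => [|[|n]]; first exact: sqr_ge0.
  by rewrite mul0r; have := HK 0%N [::] isT; rewrite big_nil.
pose W := [seq wpow v p ++ u ++ wpow v (n - p) | p <- iota 0 n.+1].
have uW : uniq W.
  rewrite map_inj_in_uniq ?iota_uniq // => p p'.
  rewrite !mem_iota /= !ltnS => pn p'n.
  wlog pp : p p' pn p'n / (p <= p')%N.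
    by case/orP: (leq_total p p') => pp H1 H2; [exact: H1 | symmetry; exact: H1].
  move=> /eqP; rewrite -(subnKC pp) wpowD -catA eqseq_cat // eqxx /=.
  case: (p' - p)%N => [|d] /=; first by rewrite addn0.
  move=> /eqP uE; case/negP: (npre (n - p)); rewrite uE -catA prefix_prefix //.
have := HK n.+1 W uW; rewrite big_map.
rewrite (eq_big_seq (fun=> normc (cf (delta (L v)) z z u) ^+ 2)); last first.
  move=> p; rewrite mem_iota /= ltnS => pn.
  by have := cf_power p (n - p); rewrite subnKC // => ->.
by rewrite big_const_seq count_predT iter_addr_0 size_iota mulr_natl.
Qed.

End Loop.

(** The path c closes f a to a loop v = f a c, whose letter f occurs once. The
word u = f w c passes the test for v unless w = a, where the diagonal case
applies; the edge g of c excludes that v and u overlap periodically. The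
coefficient of delta (L_v) at u therefore vanishes, and the Leibniz rule for
L_(f a) L_c splits it into the two coefficients below. *)
Lemma fresh_coef f a c g w :
  is_path (src f) a -> is_path (wsrc (src f) a) c ->
  wsrc (wsrc (src f) a) c = rng f ->
  f \notin a -> f \notin c -> f \notin w -> g \in c -> g \notin w ->
  (prefix a (w ++ c) -> (size a <= size w)%N) ->
  cf (delta (L (f :: a))) (wsrc (src f) a) (rng f) (f :: w) =
    if prefix a w
    then - cf (delta (L c)) (rng f) (wsrc (src f) a) (drop (size a) w ++ c)
    else 0.
Proof.
move=> pa pc sc fa fc fw gc gw short; set x := wsrc (src f) a in pc sc *.
have pv : is_path (rng f) (f :: a ++ c) by rewrite /= eqxx path_cat pa.
have sv : wsrc (rng f) (f :: a ++ c) = rng f.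
  by rewrite -[f :: _]cat_cons wsrc_cat.
have fac : f \notin a ++ c by rewrite mem_cat negb_or fa.
have fwc : f \notin w ++ c by rewrite mem_cat negb_or fw.
have vanish : cf (delta (L (f :: a ++ c))) (rng f) (rng f) (f :: w ++ c) = 0.
  have [->|wa] := eqVneq w a; first exact: delta_loop_diag.
  apply: delta_loop_coef => // [p|q].
    apply/negP => /(suffix_last_letter fwc fac) /eqP.
    by move/eqP/cat_cancelr/eqP; rewrite (negPf wa).
  apply/negP => /(prefix_fresh fac) /(prefix_closing gc gw) /eqP.
  by rewrite (negPf wa).
move: vanish; rewrite -cat_cons delta_cat cfD -cat_cons.
rewrite (cf_wordr_cat _ _ (delta_good _) pc sc).
move/eqP; rewrite addr_eq0 => /eqP ->.
have pfa : is_path (rng f) (f :: a) by rewrite /= eqxx.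
case: ifP => [/prefixP[r ->]|naw].
  by rewrite drop_size_cat // -cat_cons -catA cf_wordl_cat.
rewrite cf_wordl_nprefix ?oppr0 //= eqxx /=.
apply: contraFN naw => pawc; exact: prefix_short pawc (short pawc).
Qed.

(** For w containing f, the word f a w c may end with the loop f a c and the
previous test fails. The longer loop k b f a c, with a second edge k at its
start, repairs this: k occurs once in it and once in the tested word. *)
Lemma fresh_coef_self f (k : E) a b c g w :
  is_path (src f) a -> is_path (src k) b -> wsrc (src k) b = rng f ->
  is_path (wsrc (src f) a) c -> wsrc (wsrc (src f) a) c = rng k ->
  f != k -> k \notin b -> k \notin a -> k \notin c -> k \notin w ->
  f \notin a -> f \notin c -> f \in w -> g \in c -> g \notin w ->
  (forall s, f \in s -> cf (delta (L c)) (rng k) (wsrc (src f) a) s = 0) ->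
  (forall s, f \in s -> k \notin s ->
    cf (delta (L (k :: b))) (rng f) (rng k) (k :: b ++ s) = 0) ->
  cf (delta (L (f :: a))) (wsrc (src f) a) (rng f) (f :: a ++ w) = 0.
Proof.
move=> pa pb sb pc sc fk kb ka kc kw fa fc fw gc gw dc dkb.
set x := wsrc (src f) a in pc sc *.
have pfac : is_path (rng f) (f :: a ++ c) by rewrite /= eqxx path_cat pa.
have sfac : wsrc (rng f) (f :: a ++ c) = rng k.
  by rewrite -[f :: _]cat_cons wsrc_cat.
have pkb : is_path (rng k) (k :: b) by rewrite /= eqxx.
have pv : is_path (rng k) (k :: b ++ f :: a ++ c).
  by rewrite -cat_cons path_cat pkb [wsrc _ _]sb.
have sv : wsrc (rng k) (k :: b ++ f :: a ++ c) = rng k.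
  by rewrite -cat_cons wsrc_cat [wsrc _ (k :: b)]sb.
have fac : f \notin a ++ c by rewrite mem_cat negb_or fa.
have kv : k \notin b ++ f :: a ++ c.
  by rewrite !(mem_cat, inE) !negb_or kb ka kc eq_sym fk.
have ku : k \notin b ++ f :: a ++ w ++ c.
  by rewrite !(mem_cat, inE) !negb_or kb ka kc kw eq_sym fk.
have cw : ~ prefix c (w ++ c).
  by move=> /(prefix_shift gc gw) w0; rewrite w0 in_nil in fw.
have vanish : cf (delta (L (k :: b ++ f :: a ++ c))) (rng k) (rng k)
    (k :: b ++ f :: a ++ w ++ c) = 0.
  apply: delta_loop_coef => // [p|q]; apply/negP.
    move=> /(suffix_last_letter ku kv) /eqP; rewrite eqseq_cat // eqxx /=.
    move=> /eqP[] /eqP; rewrite eqseq_cat // eqxx /= => /eqP wcE.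
    by apply: cw; rewrite wcE prefix_refl.
  move=> /(prefix_fresh kv); rewrite prefix_catr // eqxx /= eqxx /=.
  by rewrite prefix_catr // eqxx.
move: vanish; rewrite -cat_cons delta_cat cfD => vanish.
have sum0 : cf (delta (L (k :: b)) \o L (f :: a ++ c)) (rng k) (rng k)
    ((k :: b) ++ f :: a ++ w ++ c) = 0.
  have [/suffixP[s sE]|ns] :=
      boolP (suffix (f :: a ++ c) ((k :: b) ++ f :: a ++ w ++ c)); last first.
    by apply: cf_wordr_nsuffix => //; exact: delta_good.
  rewrite sE (cf_wordr_cat _ _ (delta_good _) pfac sfac).
  have [w1 [w2 [wE fw2]]] := split_last fw.
  have sE' : s = k :: b ++ f :: a ++ w1.
    move: sE; rewrite wE.
    have -> : s ++ f :: a ++ c = (s ++ f :: a) ++ c by rewrite -catA.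
    have -> : (k :: b) ++ f :: a ++ (w1 ++ f :: w2) ++ c =
        ((k :: b ++ f :: a ++ w1) ++ f :: w2) ++ c.
      by rewrite /= -!catA /= -!catA.
    by move=> /cat_cancelr /(last_letter fw2 fa)[].
  rewrite sE'; apply: dkb; first by rewrite mem_head.
  move: kw ka; rewrite wE !(mem_cat, inE) !negb_or => /andP[-> _] ->.
  by rewrite eq_sym fk.
move: vanish; rewrite sum0 add0r cf_wordl_cat // [wsrc _ _]sb.
rewrite -cat_cons delta_cat cfD -cat_cons catA.
rewrite (cf_wordr_cat _ _ (delta_good _) pc sc) -catA.
have pfa : is_path (rng f) (f :: a) by rewrite /= eqxx.
by rewrite cf_wordl_cat // dc ?addr0 // mem_cat fw.
Qed.

End Tests.

(** * Reduction to derivations that kill the vertices *)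

Section Normalisation.
Variables (R : realType) (G : digraph).
Local Notation C := R[i].
Local Notation V := (vertex G).
Local Notation E := (edge G).
Local Notation H := (ell2 R (dipath G)).
Local Notation is_path := (@is_path G).
Local Notation TA := (tensor_algebra R G).
Local Notation P := (@Lvertex R G).
Implicit Types (h : H) (x y z : V) (A B T : H -> H).

Lemma op_sum (J : Type) (r : seq J) (F : J -> H -> H) h :
  (\sum_(j <- r) F j) h = \sum_(j <- r) F j h.
Proof. by elim/big_rec2: _ => // j A k _ <-. Qed.

Lemma vertex_comp x y h : P x (P y h) = if x == y then P x h else 0.
Proof.
apply: entry_ext => z s; rewrite !entry_vertex.
case: (eqVneq x y) => [<-|xy]; first by rewrite entry_vertex; case: eqP.
by rewrite entry0; case: eqP => // ->; rewrite (negPf xy).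
Qed.

(** The inner derivation implemented by T. *)
Definition commutator T : (H -> H) -> (H -> H) :=
  fun A => (A \o T) - (T \o A).

Lemma commutatorE T A h : commutator T A h = A (T h) - T (A h).
Proof. by []. Qed.

Lemma TA_commutator T A : TA T -> TA A -> TA (commutator T A).
Proof. by move=> TT TA'; apply: TAB; apply: TA_comp. Qed.

Lemma derivation_sub delta T : TA T -> derivation TA delta ->
  derivation TA (fun A => delta A - commutator T A).
Proof.
move=> TT der; have linT := TA_linear TT; split.
- by move=> A TA'; apply: TAB; [exact: (der_TA der TA')|exact: TA_commutator].
- move=> c A B TA' TB; rewrite (der_lincomb der c TA' TB).
  apply/funext => h.
  change (c *: delta A h + delta B h -
      ((c *: A (T h) + B (T h)) - T (c *: A h + B h)) =
    c *: (delta A h - (A (T h) - T (A h))) +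
      (delta B h - (B (T h) - T (B h)))).
  rewrite (linopD linT) (linopZ linT) !scalerBr [RHS]addrACA -opprD.
  by congr (_ - _); rewrite [RHS]addrACA -opprD.
- move=> A B TA' TB; rewrite (der_comp der TA' TB).
  have linA := TA_linear TA'.
  apply/funext => h.
  change (delta A (B h) + A (delta B h) - (A (B (T h)) - T (A (B h))) =
    (delta A (B h) - (A (T (B h)) - T (A (B h)))) +
      A (delta B h - (B (T h) - T (B h)))).
  rewrite !(linopB linA) addrACA -opprD; congr (_ - _).
  by rewrite [RHS]addrC addrA subrK.
Qed.

Variable vs : seq V.
Hypotheses (uvs : uniq vs) (allvs : forall x, x \in vs).

Lemma sum_vertex h : \sum_(x <- vs) P x h = h.
Proof.
apply: entry_ext => y s; rewrite entry_sum (bigD1_seq y) //= entry_vertex eqxx.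
rewrite big1_seq ?addr0 // => x /andP[xy _].
by rewrite entry_vertex eq_sym (negPf xy).
Qed.

Lemma TA_id : TA id.
Proof.
have -> : (id : H -> H) = \sum_(x <- vs) P x.
  by apply/funext => h; rewrite op_sum sum_vertex.
by apply: TA_sum => x; apply: TA_vertex.
Qed.

(** The classical averaging argument for the finite-dimensional commutative
algebra spanned by the vertex projections P_y: the element
sum_y P_y delta (P_y) implements delta on it. *)
Lemma vertex_inner delta : derivation TA delta ->
  exists2 T, TA T & forall x, delta (P x) = commutator T (P x).
Proof.
move=> der; have Pv x : TA (P x) by exact: TA_vertex.
have linP x : linear (P x) by exact: Lvertex_linear.
have dP x : linear (delta (P x)) by apply: TA_linear; exact: (der_TA der).
exists (\sum_(y <- vs) (P y \o delta (P y))).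
  by apply: TA_sum => y; apply: TA_comp => //; exact: (der_TA der).
move=> x; apply/funext => h; rewrite commutatorE !op_sum (linop_sum (linP x)).
have leibniz y : P y (delta (P y) (P x h)) =
    (if y == x then P x (delta (P x) h) else 0) - P y (delta (P x) h).
  have [->|yx] := eqVneq y x.
    have PP : P x \o P x = P x.
      by apply/funext => k; rewrite /= vertex_comp eqxx.
    have := der_comp der (Pv x) (Pv x); rewrite PP => dE.
    have := congr1 (fun T => P x (T h)) dE; rewrite opD /= (linopD (linP x)).
    rewrite [P x (P x _)]vertex_comp eqxx subrr => /eqP.
    by rewrite -subr_eq subrr eq_sym => /eqP.
  have PP : P y \o P x = 0.
    by apply/funext => k; rewrite /= vertex_comp (negPf yx).
  have := der_comp der (Pv y) (Pv x); rewrite PP (der0 der) => dE.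
  have := congr1 (fun T => P y (T h)) dE; rewrite op0 opD /= (linop0 (linP y)).
  rewrite (linopD (linP y)) [P y (P y _)]vertex_comp eqxx sub0r => /esym/eqP.
  by rewrite addr_eq0 => /eqP.
rewrite (eq_bigr (fun y => if y == x then P x (delta (P x) h) else 0)); last first.
  move=> y _; rewrite /= vertex_comp eq_sym; case: eqP => [->|//].
  by [].
rewrite [X in _ - X](eq_bigr _ (fun y _ => leibniz y)) /= sumrB sum_vertex.
by rewrite opprB addrC subrK.
Qed.

End Normalisation.

(** * Countability and connectedness *)

Section Graph.
Variable G : digraph.
Local Notation V := (vertex G).
Local Notation E := (edge G).
Local Notation is_path := (@is_path G).
Implicit Types (x y z : V) (s t : seq E) (e f g : E).

Lemma connected_word : strongly_connected G ->
  forall x y, exists s, is_path y s /\ wsrc y s = x.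
Proof.
move=> conn x y; have [w [sw rw]] := conn x y.
exists (pedges w); rewrite -rw; split; first exact: (svalP w).
by rewrite -sw.
Qed.

Lemma no_leading_loop x z s : is_path x s -> wsrc x s = z ->
  exists t, [/\ is_path x t, wsrc x t = z &
    forall e t', t = e :: t' -> src e != x].
Proof.
elim: s => [|e s IH] ps ss; first by exists [::].
have [ex|ex] := eqVneq (src e) x; last first.
  by exists (e :: s); split=> // e' t' [<- _].
have /andP[_ ps'] := ps; move: ss; rewrite /wsrc /= ex => ss.
by apply: IH => //; rewrite -ex.
Qed.

Lemma uncountable_bundle : finite_set [set: V] -> ~ countable [set: E] ->
  exists x z, ~ countable [set e : E | src e = x /\ rng e = z].
Proof.
move=> finV; apply: contra_notP => all_countable.
have -> : [set: E] = \bigcup_(xz in [set: V * V])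
    [set e | src e = xz.1 /\ rng e = xz.2].
  by apply/seteqP; split=> // e _; exists (src e, rng e).
apply: bigcup_countable => [|xz _].
  apply: finite_set_countable; rewrite -setXTT; exact: finite_setX.
apply: contrapT => nc; apply: all_countable; by exists xz.1, xz.2.
Qed.

End Graph.

Section Choice.
Variable T : choiceType.
Implicit Types (U B : set T) (W : seq T).

Lemma uncountable_avoid U B W : ~ countable U -> countable B ->
  exists f, [/\ U f, ~ B f & f \notin W].
Proof.
move=> nU cB; apply: contrapT => none; apply: nU.
apply: (@sub_countable _ _ _ (B `|` [set` W])); last first.
  rewrite -bigcup2E; apply: bigcup_countable => // -[|[|i]] _ //=.
  exact/finite_set_countable/finite_seq.
apply: subset_card_le => f Uf; apply: contrapT => /not_orP[nB nW].
apply: none; exists f; split=> //; exact/negP.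
Qed.

Lemma uncountable_seq U : ~ countable U ->
  exists g : nat -> T, injective g /\ forall i, U (g i).
Proof.
move=> nU; have : infinite_set U by move=> /finite_set_countable.
move=> /infiniteP /card_leP[g].
exists (fun i => val (g (exist _ i (mem_setT i)))); split=> [i j /val_inj|i].
  by move=> /(@inj _ _ _ g) - /(_ (mem_setT _) (mem_setT _)) [].
exact: set_mem (valP (g _)).
Qed.

Lemma injective_avoid (g : nat -> T) W : injective g -> exists i, g i \notin W.
Proof.
move=> inj_g; apply: contrapT => none.
have sub : {subset [seq g i | i <- iota 0 (size W).+1] <= W}.
  by move=> _ /mapP[i _ ->]; apply: contrapT => /negP gi; apply: none; exists i.
have u : uniq [seq g i | i <- iota 0 (size W).+1].
  by rewrite map_inj_uniq // iota_uniq.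
by have := uniq_leq_size u sub; rewrite size_map size_iota ltnn.
Qed.

End Choice.

Lemma countable_letters (R : realType) (G : digraph)
    (h : ell2 R (dipath G)) :
  countable [set e | exists y s, e \in s /\ entry h y s != 0].
Proof.
apply: (@sub_countable _ _ _
  (\bigcup_(w in [set w | h w != 0]) [set` pedges w])); last first.
  apply: bigcup_countable => [|w _]; first exact: countable_support.
  exact/finite_set_countable/finite_seq.
apply: subset_card_le => e [y [s [es]]]; rewrite /entry.
by case: insubP => [w _ wE hw|_]; [exists w; rewrite //= /pedges wE|rewrite eqxx].
Qed.

(** * The implementing operator *)

Section NormalisedDerivation.
Variables (R : realType) (G : digraph).
Local Notation C := R[i].
Local Notation V := (vertex G).
Local Notation E := (edge G).
Local Notation H := (ell2 R (dipath G)).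
Local Notation is_path := (@is_path G).
Local Notation TA := (tensor_algebra R G).
Local Notation L := (@Lword R G).
Local Notation P := (@Lvertex R G).
Implicit Types (h : H) (x y z : V) (s t w : seq E) (e f : E) (A B T : H -> H).

Variable vs : seq V.
Hypotheses (uvs : uniq vs) (allvs : forall x, x \in vs).
Variables (x0 z0 : V).
Local Notation U := [set e : E | src e = x0 /\ rng e = z0].
Hypothesis uncountableU : ~ countable U.
Variable g : nat -> E.
Hypotheses (inj_g : injective g) (Ug : forall i, U (g i)).
Variables (a p : V -> seq E) (q : seq E).
Hypotheses (pa : forall x, is_path x0 (a x)) (sa : forall x, wsrc x0 (a x) = x).
Hypotheses (pp : forall x, is_path x (p x)) (sp : forall x, wsrc x (p x) = z0).
Hypothesis noloop : forall x e t, p x = e :: t -> src e != x.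
Hypotheses (pq : is_path x0 q) (srcq : wsrc x0 q = z0).

Variable delta : (H -> H) -> (H -> H).
Hypothesis der : derivation TA delta.
Hypothesis delta_vertex : forall x, delta (P x) = 0.

Let TAid : TA id := @TA_id R G vs uvs allvs.

Let src_g i : src (g i) = x0. Proof. by have [] := Ug i. Qed.
Let rng_g i : rng (g i) = z0. Proof. by have [] := Ug i. Qed.

Lemma continuity z h : exists K : R, forall A, TA A ->
  (forall k, sq (A k) <= sq k) -> sq (P z (delta A h)) <= K.
Proof.
have [|||| K HK] := @continuity_at R G delta der z0 (g 0%N) (g 1%N) q (a z) h.
- by apply/eqP => /inj_g.
- by rewrite /= rng_g eqxx src_g.
- by rewrite /wsrc /= src_g.
- by rewrite /= rng_g eqxx src_g pa.
exists K => A TA' A1; have := HK A TA' A1.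
by rewrite /wsrc /= src_g -/(wsrc x0 (a z)) sa.
Qed.

Lemma continuity_scaled z h : exists2 K : R, 0 <= K & forall A, TA A ->
  forall d : R, 0 < d -> sqbound d A -> sq (P z (delta A h)) <= d * K.
Proof.
have [K HK] := continuity z h.
exists K => [|A TA' d d0 Ad].
  have z1 k : sq ((0 : H -> H) k) <= sq k by rewrite op0 sq0 sq_ge0.
  exact: le_trans (sq_ge0 _) (HK 0 (@TA0 R G) z1).
set b := Num.sqrt d; have b0 : 0 < b by rewrite sqrtr_gt0.
have bd : b ^+ 2 = d by rewrite sqr_sqrtr // ltW.
have TAb : TA ((b^-1)%:C *: A) by apply: TAZ.
have contr k : sq (((b^-1)%:C *: A) k) <= sq k.
  rewrite opZ; apply: le_trans (sqZ _ _) _.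
  rewrite normc_real ?invr_ge0 ?(ltW b0) // exprVn bd.
  by rewrite ler_pdivrMl // Ad.
have AE : A = b%:C *: ((b^-1)%:C *: A).
  by rewrite scalerA -rmorphM mulfV ?gt_eqF // rmorph1 scale1r.
rewrite AE (derZ der _ TAb) opZ (linopZ (@Lvertex_linear R G z)).
apply: le_trans (sqZ _ _) _; rewrite normc_real ?(ltW b0) // bd.
by rewrite ler_wpM2l ?(ltW d0) // HK.
Qed.

(** The set of A at which delta and the inner derivation agree is a subalgebra;
it is closed because both are continuous. *)
Lemma inner_closed T : TA T ->
  (forall e, delta (Ledge e) = commutator T (Ledge e)) ->
  (forall x, delta (P x) = commutator T (P x)) ->
  forall A, TA A -> delta A = commutator T A.
Proof.
move=> TT Te Tv; have linT := TA_linear TT.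
suff : TA `<=` [set A | TA A /\ delta A = commutator T A] by move=> S A /S[].
apply: TA_min => [|e|x]; last 2 first.
- by split; [exact: TA_edge|exact: Te].
- by split; [exact: TA_vertex|exact: Tv].
have der' := derivation_sub TT der.
apply: closed_subalgebraP.
- by move=> A [/TA_bounded].
- split; first exact: TA0.
  by apply/eqP; rewrite -subr_eq0 (der0 der').
- move=> c A B [TA' dA] [TB dB]; split; first exact: TA_lincomb.
  apply/eqP; rewrite -subr_eq0 (der_lincomb der' c TA' TB).
  by rewrite dA dB !subrr scaler0 addr0.
- move=> A B [TA' dA] [TB dB]; split; first exact: TA_comp.
  apply/eqP; rewrite -subr_eq0 (der_comp der' TA' TB).
  rewrite dA dB !subrr; apply/eqP/funext => h.
  by rewrite opD /= op0 (linop0 (TA_linear TA')) addr0.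
move=> B bB app.
have TB : TA B by apply: TA_lim => // d /app[A [TA' _] BA]; exists A.
split=> //; apply/funext => h; apply: entry_ext => y s.
apply/eqP; rewrite -subr_eq0 -entryB; apply/eqP.
have [K K0 HK] := continuity_scaled y h.
have [M M0 MT] := bounded_sqbound (TA_bounded TT).
apply: (@normc_small _ _ (4 * K + 4 * (4 * sq (T h) + 4 * (M * sq h)))) => d d0.
have [A [TA' dA] BA] := app d d0; have TBA := TAB TB TA'.
have -> : delta B h - commutator T B h =
    delta (B - A) h - commutator T (B - A) h.
  have := derB der' TB TA'; rewrite dA subrr subr0.
  by move=> /(congr1 (fun F => F h)).
set D := (B - A : H -> H) in BA TBA *.
have -> : entry (delta D h - commutator T D h) y s =
    entry (P y (delta D h - commutator T D h)) y s.
  by rewrite entry_vertex eqxx.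
apply: le_trans (entry_le_sqr _ _ _) _.
rewrite (linopB (@Lvertex_linear R G y)); apply: le_trans (sqB _ _) _.
have b1 := HK D TBA d d0 BA.
have b2 := sq_vertex y (commutator T D h).
have b3 : sq (commutator T D h) <= 4 * (d * sq (T h)) + 4 * (M * (d * sq h)).
  rewrite commutatorE; apply: le_trans (sqB _ _) _.
  rewrite lerD // ler_wpM2l //; apply: le_trans (MT _) _.
  by rewrite ler_wpM2l.
lra.
Qed.

(** ** Fresh edges *)

(** These paths close f a_x to a loop. The index i lets the edge g_i avoid any
given word, and the paths p_x do not start with a loop, which settles the
comparison of words shorter than a_x. *)
Definition closing x i := p x ++ g i :: q.

Lemma closing_path x i : is_path x (closing x i).
Proof. by rewrite path_cat pp sp /= rng_g eqxx src_g. Qed.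

Lemma closing_src x i : wsrc x (closing x i) = z0.
Proof. by rewrite wsrc_cat sp /wsrc /= src_g. Qed.

Lemma mem_closing x i : g i \in closing x i.
Proof. by rewrite mem_cat mem_head orbT. Qed.

Lemma closing_head x i e : src e = x -> g i != e -> ~~ prefix [:: e] (closing x i).
Proof.
move=> ex gie; apply/negP; rewrite /closing; case pE: (p x) => [|e' t] /=.
  by rewrite prefix0s andbT eq_sym (negPf gie).
rewrite prefix0s andbT => /eqP ee; have := noloop pE.
by rewrite -ee ex eqxx.
Qed.

(** The edges that the countable data mention; all other edges of the bundle are
interchangeable. *)
Definition tainted : set E := \bigcup_(x in [set: V]) ([set` a x] `|`
  \bigcup_(i in [set: nat]) ([set` closing x i] `|`
    [set e | exists y s, e \in s /\ cf (delta (L (closing x i))) z0 y s != 0])).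

Lemma countable_setU (X : choiceType) (A B : set X) :
  countable A -> countable B -> countable (A `|` B).
Proof.
by move=> cA cB; rewrite -bigcup2E; apply: bigcup_countable => // -[|[|i]].
Qed.

Lemma countable_tainted : countable tainted.
Proof.
apply: bigcup_countable => [|x _].
  apply: finite_set_countable; apply: (@sub_finite_set _ _ [set` vs]).
    by move=> x _ /=; exact: allvs.
  exact: finite_seq.
apply: countable_setU; first exact/finite_set_countable/finite_seq.
apply: bigcup_countable => // i _; apply: countable_setU.
  exact/finite_set_countable/finite_seq.
exact: countable_letters.
Qed.

Definition fresh f := U f /\ ~ tainted f.

Lemma fresh_exists (W : seq E) : exists2 f, fresh f & f \notin W.
Proof.
have [f [Uf tf fW]] := uncountable_avoid W uncountableU countable_tainted.
by exists f.
Qed.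

Lemma fresh_a f x : fresh f -> f \notin a x.
Proof. by move=> [_ tf]; apply/negP => fa; apply: tf; exists x => //; left. Qed.

Lemma fresh_closing f x i : fresh f -> f \notin closing x i.
Proof.
move=> [_ tf]; apply/negP => fc; apply: tf; exists x => //; right.
by exists i => //; left.
Qed.

Lemma fresh_q f : fresh f -> f \notin q.
Proof.
move=> /(fresh_closing z0 0); apply: contra => fq.
by rewrite mem_cat inE fq !orbT.
Qed.

Lemma fresh_cf f x i y s : fresh f -> f \in s ->
  cf (delta (L (closing x i))) z0 y s = 0.
Proof.
move=> [_ tf] fs; apply/eqP/negPn/negP => n0; apply: tf; exists x => //; right.
by exists i => //; right; exists y, s.
Qed.

Lemma fresh_value f x b i w : fresh f ->
  is_path x0 b -> wsrc x0 b = x -> f \notin b -> f \notin w -> g i \notin w ->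
  (prefix b (w ++ closing x i) -> (size b <= size w)%N) ->
  cf (delta (L (f :: b))) x z0 (f :: w) =
    if prefix b w
    then - cf (delta (L (closing x i))) z0 x (drop (size b) w ++ closing x i) else 0.
Proof.
move=> ff pb sb fb fw giw short; have [[sf rf] _] := ff.
have := @fresh_coef R G delta der TAid continuity f b (closing x i) (g i) w.
rewrite sf rf sb; apply=> //; [exact: closing_path|exact: closing_src|exact: fresh_closing|].
exact: mem_closing.
Qed.

(** The coefficient at w of the implementing operator, as seen by f. *)
Definition tcoef f x w := cf (delta (L (f :: a x))) x z0 (f :: a x ++ w).

(** The right-hand side does not involve f, which is why one operator serves all
edges at once. If f occurs in w, both sides vanish. *)
Lemma tcoefE f x w i : fresh f -> g i \notin a x ++ w ->
  tcoef f x w = - cf (delta (L (closing x i))) z0 x (w ++ closing x i).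
Proof.
move=> ff gi; have fa := fresh_a x ff.
have [fw|fw] := boolP (f \in w); last first.
  rewrite /tcoef (@fresh_value f x (a x) i) //.
  - by rewrite prefix_prefix drop_size_cat.
  - by rewrite mem_cat negb_or fa.
  - by rewrite size_cat leq_addr.
rewrite (fresh_cf _ _ _ ff); last by rewrite mem_cat fw.
rewrite oppr0 /tcoef; have [k fk] := fresh_exists (f :: w).
rewrite inE negb_or => /andP[kf kw].
have [[sf rf] _] := ff; have [[sk rk] _] := fk.
have := @fresh_coef_self R G delta der TAid continuity f k (a x) q (closing x i) (g i) w.
rewrite sf rf sk rk sa; apply => //.
- exact: closing_path.
- exact: closing_src.
- by rewrite eq_sym.
- exact: fresh_q.
- exact: fresh_a.
- exact: fresh_closing.
- exact: fresh_closing.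
- exact: mem_closing.
- by move: gi; rewrite mem_cat negb_or => /andP[].
- by move=> s fs; exact: (fresh_cf _ _ _ ff fs).
move=> s fs ks; have [j gj] := injective_avoid (q ++ s) inj_g.
rewrite (@fresh_value k z0 q j) //.
- rewrite prefix_prefix drop_size_cat // (fresh_cf _ _ _ ff) ?oppr0 //.
  by rewrite mem_cat fs.
- exact: fresh_q.
- by rewrite mem_cat negb_or fresh_q ?ks.
- by rewrite size_cat leq_addr.
Qed.

Lemma tcoef_indep f f' x w : fresh f -> fresh f' -> tcoef f x w = tcoef f' x w.
Proof.
move=> ff ff'; have [i gi] := injective_avoid (a x ++ w) inj_g.
by rewrite (tcoefE ff gi) (tcoefE ff' gi).
Qed.

Lemma delta_range y A : TA A -> P y \o A = A ->
  forall x z s, z != y -> cf (delta A) x z s = 0.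
Proof.
move=> TA' PA x z s zy; have Py : TA (P y) by exact: TA_vertex.
have := der_comp der Py TA'; rewrite PA delta_vertex => ->.
by rewrite cfD {1}/cf /= op0 entry0 add0r /cf /= entry_vertex (negPf zy).
Qed.

Lemma vertex_vac y x : P y (vac R x) = if x == y then vac R x else 0.
Proof.
apply: entry_ext => z s; rewrite entry_vertex !entry_vac.
have [->|xy] := eqVneq x y.
  by rewrite entry_vac; case: eqP.
by rewrite entry0; case: (eqVneq z y) => // ->; rewrite eq_sym (negPf xy).
Qed.

Lemma delta_source y A : TA A -> A \o P y = A ->
  forall x z s, x != y -> cf (delta A) x z s = 0.
Proof.
move=> TA' AP x z s xy; have Py : TA (P y) by exact: TA_vertex.
have := der_comp der TA' Py; rewrite AP delta_vertex => ->.
rewrite cfD {1}/cf /= vertex_vac (negPf xy).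
rewrite (linop0 (TA_linear (der_TA der TA'))) entry0 add0r.
by rewrite /cf /= op0 (linop0 (TA_linear TA')) entry0.
Qed.

(** The path a_y e, with y the range of e, is a path from the source of e to x0,
as good as the chosen one for reading off the coefficients. *)
Lemma tcoef_left e f w : fresh f -> f \notin e :: w ->
  cf (delta (L (f :: a (rng e) ++ [:: e]))) (src e) z0 (f :: a (rng e) ++ w) =
    if w is e' :: w' then if e' == e then tcoef f (src e) w' else 0 else 0.
Proof.
move=> ff; rewrite inE negb_or => /andP[fe fw]; set b := a (rng e).
have [i +] := injective_avoid (a (src e) ++ b ++ e :: w) inj_g.
rewrite !(mem_cat, inE) !negb_or => /and4P[gx gb ge gw].
rewrite (@fresh_value f (src e) (b ++ [:: e]) i) //.
- rewrite prefix_catr // eqxx /=; case: w fw gw => [|e' w] //= fw gw.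
  rewrite prefix0s andbT [e == e']eq_sym; case: (eqVneq e' e) => // ->.
  rewrite (@tcoefE f (src e) w i) //.
    have -> : b ++ e :: w = (b ++ [:: e]) ++ w by rewrite -catA.
    by rewrite drop_size_cat.
  by rewrite mem_cat negb_or gx; move: gw; rewrite inE negb_or => /andP[].
- by rewrite path_cat pa sa /= eqxx.
- by rewrite wsrc_cat.
- by rewrite mem_cat negb_or fresh_a //= inE.
- by rewrite mem_cat negb_or fresh_a.
- by rewrite mem_cat negb_or gb.
rewrite -catA prefix_catr // eqxx /= !size_cat leq_add2l.
case: w {fw gw} => // ce; have := @closing_head (src e) i e erefl ge.
by rewrite ce.
Qed.

Lemma tcoef_right e f w : fresh f -> f \notin e :: w ->
  cf (delta (L (f :: a (rng e))) \o Ledge e) (src e) z0 (f :: a (rng e) ++ w) =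
    if (w != [::]) && (last e w == e)
    then tcoef f (rng e) (take (size w).-1 w) else 0.
Proof.
move=> ff; rewrite inE negb_or => /andP[fe fw]; set b := a (rng e).
rewrite (cf_edger _ _ _ _ (delta_good der TAid (f :: b))) eqxx /=.
case/lastP: w fw => [|w e'] fw; last first.
  have t1 : take (size b + size w) (b ++ rcons w e') = b ++ w.
    by rewrite -cats1 catA take_size_cat ?size_cat.
  have t2 : take (size w) (rcons w e') = w by rewrite -cats1 take_size_cat.
  rewrite last_cat !last_rcons size_cat !size_rcons addnS /= t1 t2.
  by case: w {fw t1 t2}.
rewrite cats0; have := sa (rng e); have := fresh_a (rng e) ff.
have := pa (rng e); rewrite -/b; case/lastP: b => [|b' e'] pb fb sb.
  by rewrite /= (negPf fe).
rewrite last_rcons; case: (eqVneq e' e) => // ee; rewrite ee in pb fb sb *.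
have eloop : src e = rng e by rewrite -[LHS](wsrc_rcons x0 b').
have [i +] := injective_avoid (rcons b' e) inj_g.
rewrite mem_rcons inE negb_or => /andP[ge gb].
have -> : take (size (rcons b' e)) (f :: rcons b' e) = f :: b'.
  by rewrite size_rcons /= -cats1 take_size_cat.
have fb' : f \notin b' by move: fb; rewrite mem_rcons inE negb_or => /andP[].
rewrite (@fresh_value f (rng e) (rcons b' e) i) //.
  case: ifP => // /size_prefix; by rewrite size_rcons ltnn.
rewrite -cats1 prefix_catr // eqxx /= => ec.
by have := closing_head eloop ge; rewrite ec.
Qed.

Lemma delta_edge_coef e f w : fresh f -> f \notin e :: w ->
  cf (delta (Ledge e)) (src e) (rng e) w =
    (if w is e' :: w' then if e' == e then tcoef f (src e) w' else 0 else 0) -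
    (if (w != [::]) && (last e w == e)
     then tcoef f (rng e) (take (size w).-1 w) else 0).
Proof.
move=> ff few; rewrite -(tcoef_left ff few) -(tcoef_right ff few).
have [[sf rf] _] := ff.
rewrite -cat_cons (delta_cat der TAid) cfD -cat_cons.
rewrite [X in _ = _ + X - _]cf_wordl_cat; last by rewrite /= rf sf eqxx pa.
have -> : wsrc z0 (f :: a (rng e)) = rng e by rewrite /wsrc /= sf; exact: sa.
by rewrite addrAC subrr add0r.
Qed.

(** The operator is the sum over the vertices x of the left quotients of
delta (L_(f a_x)) by f a_x. *)
Lemma implementing_operator f : fresh f -> exists2 T, TA T &
  forall x y s, cf T x y s = if x == y then tcoef f y s else 0.
Proof.
move=> ff; have [[sf rf] _] := ff.
have pfa x : is_path z0 (f :: a x) by rewrite /= rf sf eqxx pa.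
have sfa x : wsrc z0 (f :: a x) = x by rewrite /wsrc /= sf; exact: sa.
have TAX x : TA (delta (L (f :: a x))).
  by apply: (der_TA der); exact: (TA_words TAid).
have /choice[Y YP] x : exists Y, TA Y /\ forall x1 y s, cf Y x1 y s =
    if y == x then cf (delta (L (f :: a x))) x1 z0 (f :: a x ++ s) else 0.
  have [Y TY YE] := left_division (pfa x) (TAX x); exists Y; split=> // x1 y s.
  by rewrite YE sfa.
exists (\sum_(x <- vs) Y x); first by apply: TA_sum => x; have [] := YP x.
move=> x y s; rewrite /cf op_sum entry_sum (bigD1_seq y) //= big1_seq ?addr0.
  have [_ YE] := YP y; rewrite -/(cf _ _ _ _) YE eqxx.
  case: (eqVneq x y) => [->//|xy].
  apply: (delta_source (y := y)) => //; first exact: (TA_words TAid).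
  apply/funext => h; apply: entry_ext => z t; rewrite [LHS]entry_word.
  rewrite [RHS]entry_word; case: ifP => // _; rewrite entry_vertex.
  have -> : wsrc z (f :: a y) = y by rewrite /wsrc /= sf; exact: sa.
  by rewrite eqxx.
move=> x' /andP[xx _]; have [_ YE] := YP x'.
by rewrite -/(cf _ _ _ _) YE eq_sym (negPf xx).
Qed.

Theorem normalised_inner : exists2 T, TA T &
  forall A, TA A -> delta A = commutator T A.
Proof.
have [f ff _] := fresh_exists [::].
have [T TT TE] := implementing_operator ff.
exists T => //; apply: inner_closed => // [e|x]; last first.
  rewrite delta_vertex; apply/esym; apply: good_cf0.
    by apply: TA_good; apply: TA_commutator => //; exact: TA_vertex.
  move=> x1 y s; rewrite cfB.
  have -> : cf (P x \o T) x1 y s = if y == x then cf T x1 y s else 0.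
    exact: entry_vertex.
  have -> : cf (T \o P x) x1 y s = if x1 == x then cf T x1 y s else 0.
    rewrite {1}/cf /= vertex_vac; case: ifP => // _.
    by rewrite (linop0 (TA_linear TT)) entry0.
  rewrite TE; case: (eqVneq x1 y) => [->|_]; first by rewrite subrr.
  by rewrite !if_same subrr.
apply/eqP; rewrite -subr_eq0; apply/eqP; apply: good_cf0.
  apply: TA_good; apply: TAB; last by apply: TA_commutator => //; exact: TA_edge.
  by apply: (der_TA der); exact: TA_edge.
move=> x y s; rewrite !cfB (cf_edger _ _ _ _ (TA_good TT)).
have -> : cf (Ledge e \o T) x y s = if s is e' :: s' then
    if (e' == e) && (y == rng e) then cf T x (src e) s' else 0 else 0.
  exact: entry_edge.
have Te : TA (Ledge e) by exact: TA_edge.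
have rngP : P (rng e) \o Ledge e = Ledge e.
  apply/funext => h; apply: entry_ext => z t; rewrite /= entry_vertex entry_edge.
  by case: (z == rng e); case: t => // e' t; rewrite andbF.
have srcP : Ledge e \o P (src e) = Ledge e.
  apply/funext => h; apply: entry_ext => z t; rewrite /= !entry_edge.
  by case: t => // e' t; rewrite entry_vertex eqxx.
have [yE|ye] := eqVneq y (rng e); last first.
  rewrite (delta_range Te rngP _ _ ye) TE [rng e == y]eq_sym (negPf ye) if_same subr0 sub0r.
  by case: s => [|e' s]; rewrite ?andbF oppr0.
have [xE|xe] := eqVneq x (src e); last first.
  rewrite (delta_source Te srcP _ _ xe) subr0 sub0r.
  by case: s => [|e' s]; rewrite ?TE ?(negPf xe) ?if_same oppr0.
have [k fk kes] := fresh_exists (e :: s).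
rewrite xE yE (delta_edge_coef fk kes) TE !eqxx /=.
apply/eqP; rewrite subr_eq0; apply/eqP; congr (_ - _); last first.
  by case: ifP => // _; exact: tcoef_indep.
case: s {kes} => // e' s; rewrite andbT TE eqxx; case: ifP => // _.
exact: tcoef_indep.
Qed.

End NormalisedDerivation.

Theorem proposition5p9 (R : realType) (G : digraph)
    (finV : finite_set [set: vertex G])
    (connG : strongly_connected G)
    (uncountableE : ~ countable [set: edge G])
    (delta : (ell2 R (dipath G) -> ell2 R (dipath G)) ->
             (ell2 R (dipath G) -> ell2 R (dipath G))) :
  derivation (tensor_algebra R G) delta ->
  inner_derivation (tensor_algebra R G) delta.
Proof.
move=> der.
have [x0 [z0 uncU]] := uncountable_bundle finV uncountableE.
have [g [inj_g Ug]] := uncountable_seq uncU.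
have /finite_seqP[s sE] := finV.
have allvs x : x \in undup s.
  by rewrite mem_undup; have : [set: vertex G] x by []; rewrite sE.
have /choice[a aP] x : exists t, is_path x0 t /\ wsrc x0 t = x.
  exact: connected_word.
have /choice[p pP] x : exists t, [/\ is_path x t, wsrc x t = z0 &
    forall e t', t = e :: t' -> src e != x].
  have [t [pt st]] := connected_word connG z0 x.
  exact: no_leading_loop pt st.
have [q [pq srcq]] := connected_word connG z0 x0.
have [T0 TT0 T0E] := vertex_inner (undup_uniq s) allvs der.
have pa x : is_path x0 (a x) by have [] := aP x.
have sa x : wsrc x0 (a x) = x by have [] := aP x.
have pp x : is_path x (p x) by have [] := pP x.
have sp x : wsrc x (p x) = z0 by have [] := pP x.
have noloop x e t : p x = e :: t -> src e != x.
  by have [_ _] := pP x; apply.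
have killed x : (delta (Lvertex x) - commutator T0 (Lvertex x))%R = 0%R.
  by rewrite T0E subrr.
have [T TT TE] := normalised_inner (undup_uniq s) allvs uncU inj_g Ug
  pa sa pp sp noloop pq srcq (derivation_sub TT0 der) killed.
exists (T0 + T)%R; first exact: TAD.
move=> A TA'; have linA := TA_linear TA'.
have := TE A TA' => /eqP; rewrite subr_eq => /eqP ->.
apply/funext => h.
change ((A (T h) - T (A h)) + (A (T0 h) - T0 (A h)) =
  A (T0 h + T h) - (T0 (A h) + T (A h)))%R.
by rewrite (linopD linA) opprD [RHS]addrACA addrC.
Qed.
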